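(* Let $(X_t\colon t\in\mathbb{Z})$ be a weakly stationary zero-mean process with values in $H=L^2([0,1])$ with $\sum_{h\in\mathbb{Z}}\|C_h\|_{\mathcal{S}}<\infty$ and spectral density operator $\mathcal{F}^X_\theta$, and let $\hat{\mathcal{F}}^X_\theta$ be an estimator of $\mathcal{F}^X_\theta$ based on a sample of size $n$. Suppose that: (B.1) $\int_{-\pi}^{\pi}E\|\mathcal{F}^X_\theta-\hat{\mathcal{F}}^X_\theta\|_{\mathcal{S}}^2\,d\theta\to0$ as $n\to\infty$; (B.2) for all $m$, $\alpha_m(\theta)$ has finitely many zeros, where $\alpha_1(\theta):=\lambda_1(\theta)-\lambda_2(\theta)$ and $\alpha_m(\theta):=\min\{\lambda_{m-1}(\theta)-\lambda_m(\theta),\lambda_m(\theta)-\lambda_{m+1}(\theta)\}$ for $m>1$; (B.3) there exists $v$ such that $\langle\varphi_m(\theta),v\rangle\ne0$ for almost all $\theta\in[-\pi,\pi]$. Let the orientations of $\varphi_m(\theta)$ and $\hat\varphi_m(\theta)$ be chosen so that $\langle\varphi_m(\theta),v\rangle$ and $\langle\hat\varphi_m(\theta),v\rangle$ are in $[0,\infty)$ for almost all $\theta$, and let $$\hat Y_{mt}:=\sum_{\ell=-L}^{L}\langle X_{t-\ell},\hat\phi_{m\ell}\rangle,\qquad m=1,\dots,p,\quad t=L+1,\dots,n-L,$$ where $L$ is some integer. Then, for some sequence $L=L(n)\to\infty$, we have $\hat Y_{mt}\to Y_{mt}$ in probability as $n\to\infty$.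
   Context: $H=L^2([0,1])$ is the Hilbert space of complex-valued square-integrable functions on $[0,1]$, with $\langle x,y\rangle=\int_0^1x(u)\overline{y(u)}\,du$ and $\|x\|=\langle x,x\rangle^{1/2}$. A zero-mean $H$-valued process $(X_t\colon t\in\mathbb{Z})$ is weakly stationary if, for all $t$, $E\|X_t\|^2<\infty$, $EX_t=0$, and, for all $h$, $c_h(u,v):=E[X_{t+h}(u)\overline{X_t(v)}]$ does not depend on $t$. $C_h$ is the operator with kernel $c_h$, and $\|\cdot\|_{\mathcal{S}}$ is the Hilbert--Schmidt norm. Spectral density operator: $\mathcal{F}^X_\theta:=\frac{1}{2\pi}\sum_{h\in\mathbb{Z}}C_he^{-\mathrm{i}h\theta}$, $\theta\in[-\pi,\pi]$; it is non-negative, self-adjoint and Hilbert--Schmidt. $\lambda_1(\theta)\ge\lambda_2(\theta)\ge\cdots\ge0$ are its eigenvalues and $\varphi_m(\theta)=\varphi_m(\cdot|\theta)$ the corresponding eigenfunctions, standardized to $\|\varphi_m(\theta)\|=1$ and assumed jointly measurable in $(u,\theta)$; $\varphi_m(\theta)$ is defined only up to a multiplicative factor on the complex unit circle. Filter coefficients: $\phi_{m\ell}(u):=\frac{1}{2\pi}\int_{-\pi}^{\pi}\varphi_m(u|s)e^{-\mathrm{i}\ell s}\,ds$ (for almost every $u$, and $0$ otherwise). Dynamic functional principal component scores: $Y_{mt}:=\sum_{\ell\in\mathbb{Z}}\langle X_{t-\ell},\phi_{m\ell}\rangle$ (convergent in mean square). $\hat\varphi_m(\theta)$ is the $m$-th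 (unit-norm) eigenfunction of the estimated operator $\hat{\mathcal{F}}^X_\theta$, and $\hat\phi_{m\ell}$ is computed from $\hat{\mathcal{F}}^X_\theta$ as $\phi_{m\ell}$ is from $\mathcal{F}^X_\theta$, i.e. $\hat\phi_{m\ell}=\frac{1}{2\pi}\int_{-\pi}^{\pi}\hat\varphi_m(s)e^{-\mathrm{i}\ell s}\,ds$. Dependence of the estimators on $n$ is suppressed in the notation. *)

(* Defs.v *)
From HB Require Import structures.
From mathcomp Require Import all_boot all_order all_algebra.
From mathcomp Require Import all_classical all_reals all_analysis.
From mathcomp Require Import complex.

Set Implicit Arguments.
Unset Strict Implicit.
Unset Printing Implicit Defensive.

Import Order.TTheory GRing.Theory Num.Theory.
Import numFieldNormedType.Exports.

Local Open Scope classical_set_scope.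
Local Open Scope ring_scope.
Local Open Scope complex_scope.

Definition cmod (R : realType) (z : R[i]) : R := ComplexField.Normc.normc z.

Definition cis (R : realType) (s : R) : R[i] := cos s +i* sin s.

Definition cmeasurable_fun d (T : measurableType d) (R : realType)
    (D : set T) (f : T -> R[i]) : Prop :=
  measurable_fun D (fun x => complex.Re (f x) : measurableTypeR R) /\
  measurable_fun D (fun x => complex.Im (f x) : measurableTypeR R).

(* A real or imaginary part whose integral diverges contributes 0. *)
Definition cintegral d (T : measurableType d) (R : realType)
    (mu : {measure set T -> \bar R}) (D : set T) (f : T -> R[i]) : R[i] :=
  Rintegral mu D (fun x => complex.Re (f x)) +i* Rintegral mu D (fun x => complex.Im (f x)).

(* Symmetric sum of [f l] over the integers [l] with [- N <= l <= N]. *)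
Definition symsum (V : zmodType) (N : nat) (f : int -> V) : V :=
  \sum_(k < N.*2.+1) f (k%:Z - N%:Z).

Section HilbertSpace.
Variable R : realType.
Local Notation leb := (@lebesgue_measure R).
Implicit Types x y : R -> R[i].

Definition unitI : set R := `[0, 1]%classic.
Definition freqI : set R := `[- pi, pi]%classic.

(* Elements of H = L^2([0,1]) are handled through representatives
   [R -> R[i]]; only their values on [0,1] matter, and equality in H is
   [eqH].  [sqnormH] is the squared norm, with value +oo outside of H. *)
Definition sqnormH x : \bar R := (\int[leb]_(u in unitI) ((cmod (x u)) ^+ 2)%:E)%E.

Definition inH x : Prop := cmeasurable_fun unitI x /\ (sqnormH x < +oo)%E.

Definition eqH x y : Prop := {ae leb, forall u, unitI u -> x u = y u}.

Definition inner x y : R[i] := cintegral leb unitI (fun u => x u * (y u)^*).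

Definition orthonormal_seq (b : nat -> R -> R[i]) : Prop :=
  (forall i, inH (b i)) /\ forall i j, inner (b i) (b j) = (i == j)%:R.

Definition orthonormal_basis (b : nat -> R -> R[i]) : Prop :=
  orthonormal_seq b /\
  forall x, inH x ->
    (fun N => sqnormH (fun u => x u - \sum_(k < N) inner x (b k) * b k u)) @ \oo
      --> 0%E.

Definition oper : Type := (R -> R[i]) -> (R -> R[i]).

Definition op_sub (S T : oper) : oper := fun x u => S x u - T x u.

Definition kernel_op (c : R -> R -> R[i]) : oper :=
  fun x u => cintegral leb unitI (fun v => c u v * x v).

Definition bounded_linear (T : oper) : Prop :=
  [/\ forall x, inH x -> inH (T x),
      forall (a : R[i]) x y, inH x -> inH y ->
        eqH (T (fun u => a * x u + y u)) (fun u => a * T x u + T y u)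
    & exists M : R, forall x, inH x ->
        (sqnormH (T x) <= (M ^+ 2)%:E * sqnormH x)%E].

Definition self_adjoint (T : oper) : Prop :=
  forall x y, inH x -> inH y -> inner (T x) y = inner x (T y).

(* Hilbert--Schmidt norm, computed in the orthonormal basis [b] (its value does
   not depend on the choice of [b]). *)
Definition hsnorm (b : nat -> R -> R[i]) (T : oper) : \bar R :=
  ((\sum_(0 <= k <oo) sqnormH (T (b k))) `^ 2^-1)%E.

Definition hilbert_schmidt (b : nat -> R -> R[i]) (T : oper) : Prop :=
  bounded_linear T /\ (hsnorm b T < +oo)%E.

Definition eigenfunction (T : oper) (l : R) (f : R -> R[i]) : Prop :=
  [/\ inH f, ~ eqH f (fun=> 0) & eqH (T f) (fun u => l%:C * f u)].

(* [l] is the eigenvalue of rank [m], from 0, in the decreasing enumeration of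
   the eigenvalues of [T] repeated according to multiplicity: [e] is a
   diagonalizing orthonormal basis in which the [m.+1] largest eigenvalues come
   first.  The others are in no particular order, since a decreasing
   enumeration of type nat need not exhaust the spectrum (T may have
   infinite rank and a nontrivial kernel). *)
Definition nth_eigenvalue (T : oper) (m : nat) (l : R) : Prop :=
  exists (e : nat -> R -> R[i]) (mu : nat -> R),
    [/\ orthonormal_basis e,
        forall j, eigenfunction T (mu j) (e j),
        forall i j, (i <= m)%N -> (i <= j)%N -> mu j <= mu i
      & mu m = l].

Definition unit_eigenfunction (T : oper) (l : R) (f : R -> R[i]) : Prop :=
  eigenfunction T l f /\ sqnormH f = 1%E.

Definition nth_unit_eigenfunction (T : oper) (m : nat) (f : R -> R[i]) : Prop :=
  exists2 l, nth_eigenvalue T m l & unit_eigenfunction T l f.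

(* With ranks starting from 0, [alpha lam m] is alpha_{m+1}(theta), where
   [lam j] is lambda_{j+1}(theta). *)
Definition alpha (lam : nat -> R) (m : nat) : R :=
  if m is k.+1 then Num.min (lam k - lam k.+1) (lam k.+1 - lam k.+2)
  else lam 0%N - lam 1%N.

(* Fourier coefficient in theta of [f], where [f s u] stands for f(u|s). *)
Definition filter_coef (f : R -> R -> R[i]) (l : int) : R -> R[i] :=
  fun u => ((2 * pi)^-1)%:C *
    cintegral leb freqI (fun s => f s u * cis (- (l%:~R * s))).

End HilbertSpace.

Section Process.
Variables (R : realType) (d : measure_display) (Omega : measurableType d).
Variable P : probability Omega R.
Local Notation leb := (@lebesgue_measure R).
Local Notation I := (@unitI R).

Definition cexpect (Z : Omega -> R[i]) : R[i] := cintegral P setT Z.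

(* H-valued process, through jointly measurable representatives: [X t w u]
   is X_t(u) at the outcome [w]. *)
Definition H_process (X : int -> Omega -> R -> R[i]) : Prop :=
  forall t,
    cmeasurable_fun (setT `*` I)
      (fun p : Omega * measurableTypeR R => X t p.1 p.2) /\
    forall w, inH (X t w).

Definition cov_kernel (X : int -> Omega -> R -> R[i]) (s t : int) (u v : R) : R[i] :=
  cexpect (fun w => X s w u * (X t w v)^*).

Definition weakly_stationary_zero_mean (X : int -> Omega -> R -> R[i]) : Prop :=
  [/\ H_process X,
      forall t, (\int[P]_w sqnormH (X t w) < +oo)%E,
      forall t, {ae leb, forall u, I u -> cexpect (fun w => X t w u) = 0}
    & forall h t, {ae (leb \x leb)%E, forall p, (I `*` I) p ->
        cov_kernel X (t + h) t p.1 p.2 = cov_kernel X h 0 p.1 p.2}].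

Definition autocov_op (X : int -> Omega -> R -> R[i]) (h : int) : oper R :=
  kernel_op (cov_kernel X h 0).

Definition spectral_partial_sum (X : int -> Omega -> R -> R[i]) (N : nat) (theta : R) :
    oper R :=
  fun x u => ((2 * pi)^-1)%:C *
    symsum N (fun h => cis (- (h%:~R * theta)) * autocov_op X h x u).

(* The series defining [F theta] converges in Hilbert--Schmidt norm. *)
Definition spectral_density_operator (b : nat -> R -> R[i])
    (X : int -> Omega -> R -> R[i]) (F : R -> oper R) : Prop :=
  forall theta, freqI theta ->
    hilbert_schmidt b (F theta) /\
    (fun N => hsnorm b (op_sub (F theta) (spectral_partial_sum X N theta))) @ \oo
      --> 0%E.

(* The truncated filter sum over |l| <= N at time [t], for the filter [f]
   (possibly random). *)
Definition filtered (X : int -> Omega -> R -> R[i]) (f : Omega -> int -> R -> R[i])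
    (N : nat) (t : int) : Omega -> R[i] :=
  fun w => symsum N (fun l => inner (X (t - l) w) (f w l)).

(* [Y] is the sum over all integers l of <X_{t-l}, f_l>, in mean square. *)
Definition mean_square_filtered (X : int -> Omega -> R -> R[i])
    (f : int -> R -> R[i]) (t : int) (Y : Omega -> R[i]) : Prop :=
  cmeasurable_fun setT Y /\
  (fun N => \int[P]_w ((cmod (Y w - filtered X (fun=> f) N t w)) ^+ 2)%:E)%E @ \oo
    --> 0%E.

Definition vanishes_in_probability (Z : nat -> Omega -> R[i]) : Prop :=
  forall eps : R, 0 < eps ->
    (fun n => P [set w | eps <= cmod (Z n w)]) @ \oo --> 0%E.

Definition sample (X : int -> Omega -> R -> R[i]) (n : nat) (w : Omega) :
    'I_n -> R -> R[i] :=
  fun i => X (i.+1)%:Z w.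

End Process.

Arguments sample {R d Omega} X n w _.

(* Main.v *)
Require Import Defs.
From HB Require Import structures.
From mathcomp Require Import all_boot all_order all_algebra.
From mathcomp Require Import all_classical all_reals all_analysis.
From mathcomp Require Import complex.
From mathcomp Require Import measurable_realfun.
From mathcomp Require Import ring lra.

(** The error of an estimated score splits into a truncation error, from cutting
    the filter series of [Y] at lag [L n], and an estimation error, from using
    [phihat] instead of [phi] in the finitely many remaining terms.

    Truncation.  By stationarity the cross moments of the variables
    [inner (X t) f] depend on time differences only ([cross_moment_stationary],
    two applications of Fubini's theorem to the covariance kernel).  Hence the
    mean square distance between two truncations is the same at all times, and
    so the truncation error tends to 0 uniformly in time
    ([mean_square_filtered_uniform]).  In the same way the mean of
    [sqnormH (X t)] is the same at all times; it is read off the coordinates in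
    the basis [b] ([expected_sqnorm_const]).

    Estimation at one frequency.  Weyl's inequality ([weyl]) bounds the
    displacement of the eigenvalue of rank [m] by the distance of the operators.
    An eigenvector of the estimator is therefore an approximate eigenvector of
    [F theta], and where the gap [alpha] is positive it must be close to the
    line of [phi] ([eigenvector_concentration]).  The common orientation with
    respect to [v] fixes its phase ([oriented_dist]).  Together, for fixed
    [theta], the squared error of the eigenfunction is at most a constant times
    the squared Hilbert-Schmidt error, and this constant does not depend on the
    estimator ([eigenfunction_stability]).

    Estimation over all frequencies.  The constant is finite at almost every
    frequency by [B2] and [B3], but nothing is known about its size or its
    measurability in [theta].  The errors of the eigenfunctions are however
    bounded by 4, and [B1] says that the mean Hilbert-Schmidt errors tend to 0
    in the integral over frequencies; this suffices for the mean errors of the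
    eigenfunctions to tend to 0 in the integral as well
    ([integral_dominated_cvg0], [eigenfunctions_consistent]).  By the
    Cauchy-Schwarz inequality the integrated error bounds the error of every
    filter coefficient at once ([sqnormH_filter_coefB_le]).

    Choice of [L].  The estimation error is a sum of [2 * L n + 1] products of
    norms.  Its mean is small when the integrated mean error times
    [(L n + 1) ^ 4] stays bounded and [L n] is large, by the inequality between
    arithmetic and geometric means ([deviation_bound]), and such an [L] exists
    because the integrated mean error tends to 0 ([slow_index]).  Markov's
    inequality concludes. *)

Set Implicit Arguments.
Unset Strict Implicit.
Unset Printing Implicit Defensive.

Import Order.TTheory GRing.Theory Num.Theory.
Import numFieldNormedType.Exports.

Local Open Scope classical_set_scope.
Local Open Scope ring_scope.
Local Open Scope complex_scope.
Local Open Scope ring_scope.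

(** * The modulus of complex numbers *)

Section ComplexModulus.
Variable R : realType.
Implicit Types (x y z : R[i]) (a t : R).

Lemma ReD x y : complex.Re (x + y) = complex.Re x + complex.Re y.
Proof. by case: x; case: y. Qed.

Lemma ImD x y : complex.Im (x + y) = complex.Im x + complex.Im y.
Proof. by case: x; case: y. Qed.

Lemma ReN x : complex.Re (- x) = - complex.Re x.
Proof. by case: x. Qed.

Lemma ImN x : complex.Im (- x) = - complex.Im x.
Proof. by case: x. Qed.

Lemma ReM x y : complex.Re (x * y) =
  complex.Re x * complex.Re y - complex.Im x * complex.Im y.
Proof. by case: x; case: y. Qed.

Lemma ImM x y : complex.Im (x * y) =
  complex.Re x * complex.Im y + complex.Im x * complex.Re y.
Proof. by case: x; case: y. Qed.

Lemma ReJ x : complex.Re x^* = complex.Re x. Proof. by case: x. Qed.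

Lemma ImJ x : complex.Im x^* = - complex.Im x. Proof. by case: x. Qed.

Lemma Re_sum (I : Type) (r : seq I) (Q : pred I) (f : I -> R[i]) :
  complex.Re (\sum_(i <- r | Q i) f i) = \sum_(i <- r | Q i) complex.Re (f i).
Proof. exact: (big_morph _ ReD). Qed.

Lemma conjM x y : (x * y)^* = x^* * y^*. Proof. exact: rmorphM. Qed.

Lemma conjD x y : (x + y)^* = x^* + y^*. Proof. exact: rmorphD. Qed.

Lemma conj_sum (I : Type) (r : seq I) (Q : pred I) (f : I -> R[i]) :
  (\sum_(i <- r | Q i) f i)^* = \sum_(i <- r | Q i) (f i)^*.
Proof. exact: rmorph_sum. Qed.

Lemma complex_eqP x y :
  complex.Re x = complex.Re y -> complex.Im x = complex.Im y -> x = y.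
Proof. by case: x => ? ?; case: y => ? ? /= -> ->. Qed.

Lemma cmod_ge0 x : 0 <= cmod x.
Proof. by case: x => a b; rewrite /cmod /= sqrtr_ge0. Qed.

Lemma sqr_cmod x : cmod x ^+ 2 = complex.Re x ^+ 2 + complex.Im x ^+ 2.
Proof. by case: x => a b; rewrite /cmod /= sqr_sqrtr// addr_ge0 ?sqr_ge0. Qed.

Lemma cmodM x y : cmod (x * y) = cmod x * cmod y.
Proof. exact: ComplexField.Normc.normcM. Qed.

Lemma cmodR a : cmod a%:C = `|a|.
Proof. by rewrite /cmod /= expr0n/= addr0 sqrtr_sqr. Qed.

Lemma cmod0 : cmod (0 : R[i]) = 0. Proof. exact: ComplexField.Normc.normc0. Qed.

Lemma cmod1 : cmod (1 : R[i]) = 1. Proof. exact: ComplexField.Normc.normc1. Qed.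

Lemma cmodN x : cmod (- x) = cmod x.
Proof. by case: x => a b; rewrite /cmod /= !sqrrN. Qed.

Lemma cmodJ x : cmod x^* = cmod x.
Proof. by case: x => a b; rewrite /cmod /= !sqrrN. Qed.

Lemma cmod_eq0 x : cmod x = 0 -> x = 0.
Proof. exact: ComplexField.Normc.eq0_normc. Qed.

Lemma le_cmodD x y : cmod (x + y) <= cmod x + cmod y.
Proof.
have : (cmod (x + y))%:C <= (cmod x)%:C + (cmod y)%:C.
  exact: (@ler_normD _ R[i]).
by rewrite -rmorphD/= lecR.
Qed.

Lemma le_cmod_sum (I : Type) (r : seq I) (Q : pred I) (f : I -> R[i]) :
  cmod (\sum_(i <- r | Q i) f i) <= \sum_(i <- r | Q i) cmod (f i).
Proof.
elim/big_ind2 : _ => //; first by rewrite cmod0.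
by move=> *; apply: (le_trans (le_cmodD _ _)); apply: lerD.
Qed.

Lemma le_Re_cmod x : `|complex.Re x| <= cmod x.
Proof.
rewrite -(@ler_sqr _ `|_|) ?nnegrE ?cmod_ge0 ?normr_ge0//.
by rewrite sqr_cmod real_normK ?num_real// lerDl sqr_ge0.
Qed.

Lemma le_Im_cmod x : `|complex.Im x| <= cmod x.
Proof.
rewrite -(@ler_sqr _ `|_|) ?nnegrE ?cmod_ge0 ?normr_ge0//.
by rewrite sqr_cmod real_normK ?num_real// lerDr sqr_ge0.
Qed.

Lemma conjRC (a : R) : a%:C^* = a%:C.
Proof. by apply: complex_eqP; rewrite ?ReJ// ImJ /= oppr0. Qed.

Lemma mulcJ x : x * x^* = (cmod x ^+ 2)%:C.
Proof.
by apply: complex_eqP; rewrite ?ReM ?ImM ReJ ImJ /= ?sqr_cmod; ring.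
Qed.

Lemma sqr_cmodD x y : cmod (x + y) ^+ 2 <= 2 * cmod x ^+ 2 + 2 * cmod y ^+ 2.
Proof.
have := sqr_ge0 (complex.Re x - complex.Re y).
have := sqr_ge0 (complex.Im x - complex.Im y).
by rewrite !sqr_cmod ReD ImD !expr2; lra.
Qed.

(** Shared by the Cauchy-Schwarz inequalities for finite sums and for semi-inner
    products.  Since the latter may be degenerate, [b] is allowed to vanish, and
    then letting [t] grow forces [c = 0]. *)
Lemma discriminant_le (a b c : R) : 0 <= a ->
  (forall t, 0 <= a - 2 * t * c + t ^+ 2 * b) -> c ^+ 2 <= a * b.
Proof.
move=> a0 H; have [b0|b0|b0] := ltgtP b 0.
- have c0 : c = 0.
    apply/eqP; apply: contraT => c0; have c2 : 0 < c ^+ 2 by rewrite exprn_even_gt0.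
    have := H ((a + 1) / (2 * c)); suff -> : a - 2 * ((a + 1) / (2 * c)) * c = -1.
      have : 0 <= ((a + 1) / (2 * c)) ^+ 2 by rewrite sqr_ge0.
      by nra.
    by field.
  have [->|a1] := eqVneq a 0; first by rewrite c0 mul0r expr0n.
  have ap : 0 < a by rewrite lt_neqAle eq_sym a1.
  have := H (Num.sqrt ((a + 1) / - b)); rewrite c0 mulr0 subr0 sqr_sqrtr.
    have -> : (a + 1) / - b * b = - (a + 1) by field; rewrite lt_eqF.
    by lra.
  by rewrite divr_ge0//; lra.
- have := H (c / b); have -> : a - 2 * (c / b) * c + (c / b) ^+ 2 * b = a - c ^+ 2 / b.
    by field; rewrite gt_eqF.
  by rewrite subr_ge0 ler_pdivrMr.
- rewrite b0 mulr0; have [->|c0] := eqVneq c 0; first by rewrite expr0n.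
  have := H ((a + 1) / (2 * c)); rewrite b0 mulr0 addr0.
  have -> : a - 2 * ((a + 1) / (2 * c)) * c = -1 by field.
  by lra.
Qed.

Lemma cauchy_schwarz_sum (I : Type) (r : seq I) (f g : I -> R) :
  (\sum_(i <- r) f i * g i) ^+ 2 <=
  (\sum_(i <- r) f i ^+ 2) * (\sum_(i <- r) g i ^+ 2).
Proof.
apply: discriminant_le => [|t]; first by apply: sumr_ge0 => i _; exact: sqr_ge0.
rewrite !mulr_sumr -sumrB -big_split/=; apply: sumr_ge0 => i _.
by have := sqr_ge0 (f i - t * g i); nra.
Qed.

End ComplexModulus.

(** * Semi-inner products *)

(** Definiteness is left out because the representatives of one class of
    square-integrable functions differ by elements of norm zero. *)
Record semi_inner (R : realType) (V : lmodType R[i]) (ip : V -> V -> R[i]) :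
    Prop := SemiInner {
  ip_lin : forall a x y z, ip (a *: x + y) z = a * ip x z + ip y z;
  ip_conj : forall x y, ip y x = (ip x y)^*;
  ip_ge0 : forall x, 0 <= complex.Re (ip x x) }.

Section SemiInnerTheory.
Variables (R : realType) (V : lmodType R[i]) (ip : V -> V -> R[i]).
Hypothesis Hip : semi_inner ip.
Implicit Types (x y z f : V) (a : R[i]) (e : nat -> V) (T : V -> V).

Definition sqn x : R := complex.Re (ip x x).

Lemma nsq_ge0 x : 0 <= sqn x. Proof. exact: ip_ge0. Qed.

Lemma ipDl x y z : ip (x + y) z = ip x z + ip y z.
Proof. by have := ip_lin Hip 1 x y z; rewrite scale1r mul1r. Qed.

Lemma ip0l z : ip 0 z = 0.
Proof. by apply: (addrI (ip 0 z)); rewrite -ipDl !addr0. Qed.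

Lemma ipZl a x z : ip (a *: x) z = a * ip x z.
Proof. by have := ip_lin Hip a x 0 z; rewrite ip0l !addr0. Qed.

Lemma ipNl x z : ip (- x) z = - ip x z.
Proof. by rewrite -scaleN1r ipZl mulN1r. Qed.

Lemma ipBl x y z : ip (x - y) z = ip x z - ip y z.
Proof. by rewrite ipDl ipNl. Qed.

Lemma ip_suml (I : Type) (r : seq I) (Q : pred I) (f : I -> V) z :
  ip (\sum_(i <- r | Q i) f i) z = \sum_(i <- r | Q i) ip (f i) z.
Proof. exact: (big_morph (ip^~ z) (fun x y => ipDl x y z) (ip0l z)). Qed.

Lemma ipDr x y z : ip z (x + y) = ip z x + ip z y.
Proof. by rewrite !(ip_conj Hip _ z) ipDl conjD. Qed.

Lemma ipZr a x z : ip z (a *: x) = a^* * ip z x.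
Proof. by rewrite !(ip_conj Hip _ z) ipZl conjM. Qed.

Lemma ipBr x y z : ip z (x - y) = ip z x - ip z y.
Proof. by rewrite !(ip_conj Hip _ z) ipBl -rmorphB. Qed.

Lemma ip_sumr (I : Type) (r : seq I) (Q : pred I) (f : I -> V) z :
  ip z (\sum_(i <- r | Q i) f i) = \sum_(i <- r | Q i) ip z (f i).
Proof.
rewrite (ip_conj Hip) ip_suml conj_sum; apply: eq_bigr => i _.
by rewrite (ip_conj Hip (f i)).
Qed.

Lemma nsqZ a x : sqn (a *: x) = cmod a ^+ 2 * sqn x.
Proof. by rewrite /sqn ipZl ipZr mulrA mulcJ ReM/= mul0r subr0. Qed.

Lemma nsqD x y : sqn (x + y) = sqn x + sqn y + 2 * complex.Re (ip x y).
Proof.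
by rewrite /sqn ipDl !ipDr !ReD (ip_conj Hip x y) ReJ; ring.
Qed.

Lemma nsqN x : sqn (- x) = sqn x.
Proof.
by rewrite -scaleN1r nsqZ cmodN cmod1 expr1n mul1r.
Qed.

Lemma nsqB x y : sqn (x - y) = sqn x + sqn y - 2 * complex.Re (ip x y).
Proof.
by rewrite nsqD nsqN (ip_conj Hip) ipNl ReJ ReN (ip_conj Hip x y) ReJ; ring.
Qed.

Lemma nsqC x y : sqn (x - y) = sqn (y - x).
Proof. by rewrite -nsqN opprB. Qed.

Lemma cauchy_schwarz x y : cmod (ip x y) ^+ 2 <= sqn x * sqn y.
Proof.
suff H : (cmod (ip x y) ^+ 2) ^+ 2 <= sqn x * (cmod (ip x y) ^+ 2 * sqn y).
  have [->|c0] := eqVneq (cmod (ip x y) ^+ 2) 0; first by rewrite mulr_ge0 ?nsq_ge0.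
  have cp : 0 < cmod (ip x y) ^+ 2 by rewrite lt_neqAle eq_sym c0 sqr_ge0.
  by rewrite -(ler_pM2l cp) -expr2 mulrCA.
apply: discriminant_le => [|t]; first exact: nsq_ge0.
have := nsq_ge0 (x - (t%:C * ip x y) *: y).
rewrite nsqB nsqZ cmodM cmodR exprMn real_normK ?num_real// ipZr.
rewrite conjM -mulrA (mulrC _ (ip x y)) mulcJ conjRC ReM/= mul0r subr0.
by nra.
Qed.

Lemma le_ip_nsq x y : sqn y = 1 -> cmod (ip x y) ^+ 2 <= sqn x.
Proof. by move=> y1; have := cauchy_schwarz x y; rewrite y1 mulr1. Qed.

Lemma ip_null x y : sqn x = 0 -> ip x y = 0.
Proof.
move=> x0; apply: cmod_eq0; apply/eqP; rewrite -sqrf_eq0 -[_ == _]/(_ == _).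
by rewrite eq_le sqr_ge0 andbT; have := cauchy_schwarz x y; rewrite x0 mul0r.
Qed.

Lemma nsqD_le x y : sqn (x + y) <= 2 * sqn x + 2 * sqn y.
Proof. by have := nsq_ge0 (x - y); rewrite nsqB nsqD; lra. Qed.

Lemma nsqB_le x y : sqn (x - y) <= 2 * sqn x + 2 * sqn y.
Proof. by have := nsq_ge0 (x + y); rewrite nsqB nsqD; lra. Qed.

Lemma nsq_congr x y : sqn (x - y) = 0 -> sqn x = sqn y.
Proof.
move=> h; rewrite -{1}(subrK y x) nsqD h (ip_null _ h) /=.
by rewrite mulr0 addr0 add0r.
Qed.

(** Pairing the combination with itself and applying the Cauchy-Schwarz
    inequality for sums.  With [g k] the image of a basis vector this bounds the
    operator norm by the Hilbert-Schmidt norm. *)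
Lemma nsq_comb_le N (c : nat -> R[i]) (g : nat -> V) :
  sqn (\sum_(k < N) c k *: g k) <=
  (\sum_(k < N) cmod (c k) ^+ 2) * (\sum_(k < N) sqn (g k)).
Proof.
set u := \sum_(k < N) _; have u0 := nsq_ge0 u.
have h1 : sqn u <= \sum_(k < N) cmod (c k) * cmod (ip (g k) u).
  rewrite /sqn {1}/u ip_suml Re_sum; apply: ler_sum => k _.
  rewrite ipZl -cmodM; apply: le_trans (le_Re_cmod _); exact: ler_norm.
have h2 : sqn u ^+ 2 <= (\sum_(k < N) cmod (c k) ^+ 2) *
    ((\sum_(k < N) sqn (g k)) * sqn u).
  apply: (@le_trans _ _ ((\sum_(k < N) cmod (c k) * cmod (ip (g k) u)) ^+ 2)).
    by rewrite ler_sqr ?nnegrE// sumr_ge0// => i _; rewrite mulr_ge0 ?cmod_ge0.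
  apply: (le_trans (cauchy_schwarz_sum _ _ _)).
  rewrite ler_wpM2l ?sumr_ge0//; first by move=> i _; rewrite sqr_ge0.
  rewrite mulr_suml; apply: ler_sum => k _; exact: cauchy_schwarz.
have [->|n0] := eqVneq (sqn u) 0.
  by rewrite mulr_ge0// sumr_ge0// => i _; rewrite ?sqr_ge0 ?nsq_ge0.
have np : 0 < sqn u by rewrite lt_neqAle eq_sym n0.
by rewrite -(ler_pM2r np) -mulrA -expr2.
Qed.

Lemma ip_cvg (u : nat -> V) x z :
  (fun N => sqn (x - u N)) @ \oo --> (0 : R) ->
  (fun N => cmod (ip x z - ip (u N) z)) @ \oo --> (0 : R).
Proof.
move=> h.
have h2 : (fun N => Num.sqrt (sqn (x - u N) * sqn z)) @ \oo --> (0 : R).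
  have h1 : (fun N => sqn (x - u N) * sqn z) @ \oo --> (0 : R).
    by rewrite -[X in _ --> X](mul0r (sqn z)); apply: cvgM => //; exact: cvg_cst.
  by rewrite -[X in _ --> X]sqrtr0; apply: continuous_cvg h1; exact: sqrt_continuous.
apply: (squeeze_cvgr _ (@cvg_cst _ _ _ _ _) h2).
apply: nearW => N; rewrite cmod_ge0/= -ipBl -(@ger0_norm _ (cmod _)) ?cmod_ge0//.
by rewrite -sqrtr_sqr ler_sqrt ?mulr_ge0 ?nsq_ge0// cauchy_schwarz.
Qed.

Lemma Re_ip_cvg (u : nat -> V) x z :
  (fun N => sqn (x - u N)) @ \oo --> (0 : R) ->
  (fun N => complex.Re (ip (u N) z)) @ \oo --> complex.Re (ip x z).
Proof.
move=> /ip_cvg-/(_ z) h; apply/cvgrPdist_le => /= eps e0.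
move/cvgrPdist_le : h => /(_ _ e0); apply: filterS => N /=.
rewrite sub0r normrN ger0_norm ?cmod_ge0//; apply: le_trans.
by apply: (le_trans _ (le_Re_cmod _)); rewrite ReD ReN.
Qed.

Lemma ip_cvg_eq (u : nat -> V) x z (c : R[i]) :
  (fun N => sqn (x - u N)) @ \oo --> (0 : R) ->
  (\forall N \near \oo, ip (u N) z = c) -> ip x z = c.
Proof.
move=> /ip_cvg-/(_ z) h hc; apply/eqP; rewrite -subr_eq0; apply/eqP/cmod_eq0.
have : (fun N => cmod (ip x z - ip (u N) z)) @ \oo --> cmod (ip x z - c).
  apply/cvgrPdist_le => /= eps e0; near=> N.
  have -> : ip (u N) z = c by near: N.
  by rewrite subrr normr0 ltW.
by move=> h'; apply: (cvg_unique _ h' h).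
Unshelve. all: by end_near. Qed.

End SemiInnerTheory.

(** * Perturbation of eigenvectors *)

Section SpectralPerturbation.
Variables (R : realType) (V : lmodType R[i]) (ip : V -> V -> R[i]).
Hypothesis Hip : semi_inner ip.
Implicit Types (x y z f g v : V) (a : R[i]) (e : nat -> V) (T : V -> V) (mu : nat -> R).
Local Notation nsq := (sqn ip).

Definition orthonormal e : Prop := forall i j, ip (e i) (e j) = (i == j)%:R.

Definition complete_orthonormal e : Prop := orthonormal e /\
  forall x, (fun N => nsq (x - \sum_(k < N) ip x (e k) *: e k)) @ \oo --> (0 : R).

(** Pairing with the basis makes sense for an operator that is linear, and maps
    [e j] to a multiple of itself, only up to null vectors. *)
Definition diagonalizes T e mu : Prop :=
  forall x j, ip (T x) (e j) = (mu j)%:C * ip x (e j).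

Lemma ip_comb e (c : nat -> R[i]) N j : orthonormal e ->
  ip (\sum_(k < N) c k *: e k) (e j) = if (j < N)%N then c j else 0.
Proof.
move=> oe; rewrite (ip_suml Hip).
under eq_bigr do rewrite (ipZl Hip) oe.
case: ifPn => [jN|jN].
  rewrite (bigD1 (Ordinal jN))//= eqxx mulr1 big1 ?addr0// => i.
  by rewrite -val_eqE/= => /negbTE ->; rewrite mulr0.
rewrite big1// => i _; case: eqP => [ij|_]; last by rewrite mulr0.
by move: jN; rewrite -ij ltn_ord.
Qed.

Lemma nsq_comb e (c : nat -> R[i]) N : orthonormal e ->
  nsq (\sum_(k < N) c k *: e k) = \sum_(k < N) cmod (c k) ^+ 2.
Proof.
move=> oe; rewrite /sqn (ip_sumr Hip) Re_sum; apply: eq_bigr => i _.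
by rewrite (ipZr Hip) ip_comb// ltn_ord mulrC mulcJ.
Qed.

Lemma nsq_remainder e x N : orthonormal e ->
  nsq (x - \sum_(k < N) ip x (e k) *: e k) =
  nsq x - \sum_(k < N) cmod (ip x (e k)) ^+ 2.
Proof.
move=> oe; rewrite (nsqB Hip) (nsq_comb (fun k => ip x (e k)))//.
suff -> : complex.Re (ip x (\sum_(k < N) ip x (e k) *: e k)) =
    \sum_(k < N) cmod (ip x (e k)) ^+ 2 by ring.
rewrite (ip_sumr Hip) Re_sum; apply: eq_bigr => i _.
by rewrite (ipZr Hip) mulrC mulcJ.
Qed.

Lemma bessel e x N : orthonormal e ->
  \sum_(k < N) cmod (ip x (e k)) ^+ 2 <= nsq x.
Proof. by move=> oe; rewrite -subr_ge0 -nsq_remainder// nsq_ge0. Qed.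

Lemma parseval e x : complete_orthonormal e ->
  (fun N => \sum_(k < N) cmod (ip x (e k)) ^+ 2) @ \oo --> nsq x.
Proof.
move=> [oe ce].
have -> : (fun N => \sum_(k < N) cmod (ip x (e k)) ^+ 2) =
    (fun N => nsq x - nsq (x - \sum_(k < N) ip x (e k) *: e k)).
  by apply/funext => N; rewrite nsq_remainder//; ring.
by rewrite -[X in _ --> X]subr0; apply: cvgB; [exact: cvg_cst|exact: ce].
Qed.

(** [ip (T x) x] is the sum of the [mu k] weighted by the squared coordinates of
    [x], of which the first [m] vanish. *)
Lemma quadratic_form_le T e mu m x : complete_orthonormal e ->
  diagonalizes T e mu -> (forall j, (m <= j)%N -> mu j <= mu m) ->
  (forall j, (j < m)%N -> ip x (e j) = 0) ->
  complex.Re (ip (T x) x) <= mu m * nsq x.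
Proof.
move=> ce de mon xj.
have h1 := Re_ip_cvg Hip (z := T x) (ce.2 x).
have h2 : (fun N => mu m * \sum_(k < N) cmod (ip x (e k)) ^+ 2) @ \oo -->
    mu m * nsq x by apply: cvgM; [exact: cvg_cst|exact: parseval].
rewrite (ip_conj Hip) ReJ; apply: ler_cvg_to h1 h2 _.
apply: nearW => N; rewrite (ip_suml Hip) Re_sum mulr_sumr.
apply: ler_sum => k _; have [km|mk] := ltnP k m.
  by rewrite xj// scale0r (ip0l Hip) cmod0 expr0n/= mulr0.
rewrite (ipZl Hip) (ip_conj Hip (T x)) de rmorphM/= conjRC mulrCA mulcJ ReM/= mul0r subr0.
by rewrite ler_wpM2r ?sqr_ge0// mon.
Qed.

Lemma quadratic_form_ge T e mu m (c : nat -> R[i]) x : orthonormal e ->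
  diagonalizes T e mu -> (forall j, (j <= m)%N -> mu m <= mu j) ->
  x = \sum_(k < m.+1) c k *: e k -> mu m * nsq x <= complex.Re (ip (T x) x).
Proof.
move=> oe de mon xE; rewrite {1}xE nsq_comb// mulr_sumr {2}xE (ip_sumr Hip) Re_sum.
apply: ler_sum => k _; rewrite (ipZr Hip) de xE ip_comb// ltn_ord.
rewrite (_ : _^* * _ = (mu k * cmod (c k) ^+ 2)%:C)/=; last first.
  by rewrite rmorphM/= -mulcJ; ring.
by rewrite ler_wpM2r ?sqr_ge0// mon// -ltnS.
Qed.

(** The coefficients are a kernel vector of the [m.+1] by [m] matrix of inner
    products. *)
Lemma exists_orthogonal_comb e e' m : orthonormal e ->
  exists c : nat -> R[i], 0 < nsq (\sum_(k < m.+1) c k *: e k) /\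
    forall j, (j < m)%N -> ip (\sum_(k < m.+1) c k *: e k) (e' j) = 0.
Proof.
move=> oe; pose A : 'M[R[i]]_(m.+1, m) := \matrix_(i, j) ip (e i) (e' j).
have : kermx A != 0.
  rewrite kermx_eq0 /row_free; apply/negP => /eqP rA.
  by have := rank_leq_col A; rewrite rA ltnn.
move=> /rowV0Pn[c /sub_kermxP cA c0]; pose g k := c 0 (inord k); exists g; split.
  rewrite nsq_comb// lt_neqAle sumr_ge0 ?andbT; last by move=> i _; exact: sqr_ge0.
  apply: contra c0; rewrite eq_sym psumr_eq0; last by move=> i _; exact: sqr_ge0.
  move=> /allP h; apply/eqP/rowP => i; rewrite mxE; apply: cmod_eq0.
  by have := h i (mem_index_enum _); rewrite /= /g inord_val sqrf_eq0 => /eqP.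
move=> j jm; have /rowP/(_ (Ordinal jm)) := cA.
rewrite !mxE => <-; rewrite (ip_suml Hip); apply: eq_bigr => i _.
by rewrite (ipZl Hip) /g inord_val mxE.
Qed.

Lemma Re_ip_le (B : R) x y : 0 <= B -> nsq x <= B ^+ 2 * nsq y ->
  complex.Re (ip x y) <= B * nsq y.
Proof.
move=> B0 h; apply: (le_trans (ler_norm _)); apply: (le_trans (le_Re_cmod _)).
rewrite -ler_sqr ?nnegrE ?cmod_ge0 ?mulr_ge0 ?nsq_ge0//.
apply: (le_trans (cauchy_schwarz Hip _ _)).
by rewrite exprMn (expr2 (nsq y)) mulrA ler_wpM2r ?nsq_ge0.
Qed.

(** The Courant-Fischer argument: a nonzero vector in the span of the first
    [m.+1] eigenvectors of [T] and orthogonal to the first [m] ones of [T']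
    separates the two quadratic forms. *)
Lemma weyl_le T T' e e' mu mu' m (B : R) : 0 <= B ->
  complete_orthonormal e -> diagonalizes T e mu ->
  (forall j, (j <= m)%N -> mu m <= mu j) ->
  complete_orthonormal e' -> diagonalizes T' e' mu' ->
  (forall j, (m <= j)%N -> mu' j <= mu' m) ->
  (forall x, nsq (T x - T' x) <= B ^+ 2 * nsq x) ->
  mu m - mu' m <= B.
Proof.
move=> B0 [oe ce] de mon ce' de' mon' hB.
have [c [x0 xj]] := exists_orthogonal_comb e' m oe.
set x := \sum_(k < _) _ in x0 xj.
have h1 := quadratic_form_ge oe de mon (erefl x).
have h2 := quadratic_form_le ce' de' mon' xj.
have := Re_ip_le B0 (hB x); rewrite (ipBl Hip) ReD ReN => h3.
by rewrite -(ler_pM2r x0) mulrBl; lra.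
Qed.

Lemma weyl T T' e e' mu mu' m (B : R) : 0 <= B ->
  complete_orthonormal e -> diagonalizes T e mu ->
  (forall i j, (i <= m)%N -> (i <= j)%N -> mu j <= mu i) ->
  complete_orthonormal e' -> diagonalizes T' e' mu' ->
  (forall i j, (i <= m)%N -> (i <= j)%N -> mu' j <= mu' i) ->
  (forall x, nsq (T x - T' x) <= B ^+ 2 * nsq x) ->
  `|mu m - mu' m| <= B.
Proof.
move=> B0 ce de mon ce' de' mon' hB; rewrite ler_norml; apply/andP; split.
  rewrite lerNl opprB.
  apply: (weyl_le B0 ce' de' _ ce de) => [j jm|j jm|x].
  - exact: mon'.
  - exact: mon.
  - by rewrite (nsqC Hip).
by apply: (weyl_le B0 ce de _ ce' de') => // j jm; [exact: mon|exact: mon'].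
Qed.

(** On every [e j] other than [e m] the residual of [f] as an eigenvector of [T]
    is at least [alpha] times the coordinate of [f], while its total norm is at
    most [2 * B]. *)
Lemma eigenvector_concentration T T' e mu m f (l' alpha B : R) :
  complete_orthonormal e -> diagonalizes T e mu -> 0 <= alpha ->
  (forall j : nat, j != m -> alpha <= `|mu j - mu m|) ->
  nsq (T' f - l'%:C *: f) = 0 -> nsq f = 1 ->
  nsq (T f - T' f) <= B ^+ 2 -> `|l' - mu m| <= B ->
  alpha ^+ 2 * (1 - cmod (ip f (e m)) ^+ 2) <= 4 * B ^+ 2.
Proof.
move=> ce de a0 gap ef f1 hB hl.
pose g := T f - (mu m)%:C *: f.
(* The residual is a perturbation error plus an eigenvalue error, both at most [B]. *)
have gle : nsq g <= 4 * B ^+ 2.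
  have -> : g = (T f - T' f) + (T' f - (mu m)%:C *: f) by rewrite addrA subrK.
  apply: (le_trans (nsqD_le Hip _ _)).
  suff : nsq (T' f - (mu m)%:C *: f) <= B ^+ 2 by lra.
  rewrite (nsq_congr Hip (y := (l' - mu m)%:C *: f)).
    by rewrite (nsqZ Hip) f1 mulr1 cmodR ler_sqr ?nnegrE ?(le_trans _ hl).
  suff -> : T' f - (mu m)%:C *: f - (l' - mu m)%:C *: f = T' f - l'%:C *: f by [].
  by rewrite -addrA -opprD -scalerDl -rmorphD/= (addrC (mu m)) subrK.
have ipg j : ip g (e j) = (mu j - mu m)%:C * ip f (e j).
  by rewrite (ipBl Hip) de (ipZl Hip) rmorphB/= mulrBl.
suff : alpha ^+ 2 * nsq f <= 4 * B ^+ 2 + alpha ^+ 2 * cmod (ip f (e m)) ^+ 2.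
  by rewrite f1; lra.
have h : (fun N => alpha ^+ 2 * \sum_(k < N) cmod (ip f (e k)) ^+ 2) @ \oo -->
    alpha ^+ 2 * nsq f by apply: cvgM; [exact: cvg_cst|exact: parseval].
apply: ler_cvg_to h (@cvg_cst _ _ _ _ _) _; apply: nearW => N.
rewrite mulr_sumr.
apply: (@le_trans _ _ (\sum_(k < N) (cmod (ip g (e k)) ^+ 2 +
    (k == m :> nat)%:R * (alpha ^+ 2 * cmod (ip f (e m)) ^+ 2)))).
  apply: ler_sum => k _; rewrite ipg cmodM cmodR exprMn.
  have [->|km] := eqVneq (k : nat) m.
    by rewrite subrr normr0 expr0n/= mul0r add0r mul1r.
  rewrite mul0r addr0 ler_wpM2r ?sqr_ge0// ler_sqr ?nnegrE ?gap//.
rewrite big_split/=; apply: lerD.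
  by apply: le_trans gle; exact: bessel ce.1.
rewrite -mulr_suml -[leRHS]mul1r ler_wpM2r//; first by rewrite mulr_ge0 ?sqr_ge0.
have [mN|Nm] := ltnP m N.
  rewrite (bigD1 (Ordinal mN))//= eqxx big1 ?addr0// => i.
  by rewrite -val_eqE/= => /negbTE ->.
by rewrite big1// => i _; rewrite ltn_eqF// (leq_trans (ltn_ord i)).
Qed.

(** Pairing [f = ip f g *: g + w] with [v] shows that the imaginary part of
    [ip f g] and its negative part are at most [cmod (ip w v) / kappa], where [w]
    is small; as [ip f g] has modulus close to 1 it is close to 1.  If its real
    part is negative, [eta] is so large that the right-hand side is at least 4. *)
Lemma oriented_dist f g v (eta kappa : R) : nsq f = 1 -> nsq g = 1 ->
  0 < kappa -> ip g v = kappa%:C -> 0 <= ip f v ->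
  1 - cmod (ip f g) ^+ 2 <= eta ->
  nsq (f - g) <= 4 * eta * (1 + 2 * (nsq v / kappa ^+ 2)).
Proof.
move=> f1 g1 k0 gv; rewrite lecE/= => /andP[/eqP ifv rfv] he.
pose a := ip f g; pose w := f - a *: g.
have nw : nsq w = 1 - cmod a ^+ 2.
  by rewrite (nsqB Hip) (nsqZ Hip) f1 g1 (ipZr Hip) -/a (mulrC a^*) mulcJ /=; ring.
have a1 : cmod a ^+ 2 <= 1 by have := nsq_ge0 Hip w; rewrite nw; lra.
have fv : ip f v = a * kappa%:C + ip w v.
  by rewrite (ipBl Hip) (ipZl Hip) gv addrC subrK.
have hp : cmod (ip w v) ^+ 2 <= eta * nsq v.
  apply: (le_trans (cauchy_schwarz Hip _ _)).
  by rewrite ler_wpM2r ?nsq_ge0// nw.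
have e0 : 0 <= eta by lra.
have W0 : 0 <= nsq v / kappa ^+ 2 by rewrite divr_ge0 ?nsq_ge0// sqr_ge0.
rewrite (nsqB Hip) f1 g1 -/a.
move: ifv rfv; rewrite fv ReD ImD ReM ImM /= !mulr0 subr0 add0r.
move: a1 he hp; rewrite -/a !sqr_cmod; move: (ip w v) => q.
set r := complex.Re a; set s := complex.Im a.
set p1 := complex.Re q; set p2 := complex.Im q.
move=> a1 he hp is0 rs0.
(* [nsq v / kappa ^+ 2] is the inverse squared cosine of the angle between [g] and [v]. *)
have rW t : t ^+ 2 * kappa ^+ 2 <= eta * nsq v -> t ^+ 2 <= eta * (nsq v / kappa ^+ 2).
  by move=> ht; rewrite mulrA ler_pdivlMr// exprn_gt0.
have sW : s ^+ 2 <= eta * (nsq v / kappa ^+ 2).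
  apply: rW; rewrite -exprMn (_ : s * kappa = - p2); last by lra.
  by rewrite sqrrN; have := sqr_ge0 p1; lra.
move: W0 rW sW; set W := nsq v / _ => W0 rW sW.
have [r0|r0] := leP 0 r.
  have r1 : r <= 1 by rewrite -(@expr_le1 _ 2)//; have := sqr_ge0 s; lra.
  have : r ^+ 2 <= r by rewrite expr2 ler_piMr.
  have : 0 <= eta * W by rewrite mulr_ge0.
  by rewrite !mulrDr; lra.
have : r ^+ 2 <= eta * W.
  apply: rW; rewrite -exprMn -sqrrN.
  have h : 0 <= - (r * kappa) <= p1.
    apply/andP; split; last by lra.
    by rewrite -mulNr; apply: mulr_ge0; [rewrite oppr_ge0|]; exact: ltW.
  have : (- (r * kappa)) ^+ 2 <= p1 ^+ 2.
    by rewrite ler_sqr ?nnegrE//; case/andP: h => h1 h2; rewrite ?(le_trans h1).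
  by have := sqr_ge0 p2; lra.
have : -1 <= r.
  rewrite lerNl -(@expr_le1 _ 2)//; last by lra.
  by rewrite sqrrN; have := sqr_ge0 s; lra.
by rewrite !mulrDr; lra.
Qed.

(** A bound of Davis-Kahan type for one simple eigenvalue, with the phase fixed
    by the orientation vector [v].  The constant is quantified before the
    perturbed operator [T'], so that it serves for a whole sequence of
    estimators. *)
Lemma eigenvector_stability T e mu m phi v (alpha kappa : R) :
  complete_orthonormal e -> diagonalizes T e mu ->
  (forall i j, (i <= m)%N -> (i <= j)%N -> mu j <= mu i) ->
  0 < alpha -> (forall j : nat, j != m -> alpha <= `|mu j - mu m|) ->
  nsq (T phi - (mu m)%:C *: phi) = 0 -> nsq phi = 1 ->
  0 < kappa -> ip phi v = kappa%:C ->
  forall T' e' mu' f (B : R),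
    complete_orthonormal e' -> diagonalizes T' e' mu' ->
    (forall i j, (i <= m)%N -> (i <= j)%N -> mu' j <= mu' i) ->
    nsq (T' f - (mu' m)%:C *: f) = 0 -> nsq f = 1 -> 0 <= ip f v ->
    0 <= B -> (forall x, nsq (T x - T' x) <= B ^+ 2 * nsq x) ->
  nsq (f - phi) <= 16 * (1 + 2 * (nsq v / kappa ^+ 2)) / alpha ^+ 2 * B ^+ 2.
Proof.
move=> ce de mon a0 gap ephi phi1 k0 pv T' e' mu' f B ce' de' mon' ef f1 fv B0 hB.
have a2 : 0 < alpha ^+ 2 by rewrite exprn_gt0.
have phie : cmod (ip phi (e m)) ^+ 2 = 1.
  apply/eqP; rewrite eq_le; apply/andP; split.
    by rewrite -phi1 (le_ip_nsq Hip)// /sqn ce.1 eqxx.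
  have := eigenvector_concentration (B := 0) ce de (ltW a0) gap ephi phi1.
  rewrite subrr /sqn (ip0l Hip) subrr normr0 expr0n/= mulr0 lexx => /(_ isT isT).
  by rewrite pmulr_rle0// subr_le0.
have phi0 : nsq (phi - ip phi (e m) *: e m) = 0.
  rewrite (nsqB Hip) (nsqZ Hip) phi1 (ipZr Hip) (mulrC (ip _ _)^*) mulcJ/= phie.
  by rewrite /sqn ce.1 eqxx /=; lra.
have fphi : cmod (ip f phi) ^+ 2 = cmod (ip f (e m)) ^+ 2.
  have := ip_null Hip f phi0; rewrite (ipBl Hip) => /subr0_eq.
  rewrite (ipZl Hip) (ip_conj Hip) => h; rewrite -(cmodJ (ip f phi)) h.
  by rewrite cmodM exprMn phie mul1r (ip_conj Hip) cmodJ.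
have hl : `|mu' m - mu m| <= B by rewrite distrC; exact: (weyl B0 ce de mon ce' de' mon' hB).
have hBf : nsq (T f - T' f) <= B ^+ 2 by rewrite -[leRHS]mulr1 -f1.
have hc : 1 - cmod (ip f phi) ^+ 2 <= 4 * B ^+ 2 / alpha ^+ 2.
  rewrite fphi ler_pdivlMr// mulrC.
  exact: eigenvector_concentration ce de (ltW a0) gap ef f1 hBf hl.
have h := oriented_dist f1 phi1 k0 pv fv hc.
apply: (le_trans h); rewrite le_eqVlt; apply/orP; left; apply/eqP.
by field; rewrite !gt_eqF.
Qed.

End SpectralPerturbation.

(** * Bounded operators on semi-inner product spaces *)

Section BoundedOperators.
Variables (R : realType) (V : lmodType R[i]) (ip : V -> V -> R[i]).
Hypothesis Hip : semi_inner ip.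
Implicit Types (x y z : V) (e b : nat -> V) (T : V -> V) (mu : nat -> R).
Local Notation nsq := (sqn ip).

(** Linearity is only asked after pairing with a vector: an operator on
    representatives is linear up to null vectors. *)
Definition bounded_op T : Prop :=
  (forall (a : R[i]) x y z, ip (T (a *: x + y)) z = a * ip (T x) z + ip (T y) z) /\
  exists M : R, forall x, nsq (T x) <= M * nsq x.

Lemma bounded_op_sub T T' : bounded_op T -> bounded_op T' ->
  bounded_op (fun x => T x - T' x).
Proof.
move=> [lT [M bT]] [lT' [M' bT']]; split.
  by move=> a x y z; rewrite !(ipBl Hip) lT lT'; ring.
exists (2 * M + 2 * M') => x; apply: (le_trans (nsqB_le Hip _ _)).
by have := bT x; have := bT' x; lra.
Qed.

Section OneOperator.
Variable T : V -> V.
Hypothesis bT : bounded_op T.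

Lemma op0 z : ip (T 0) z = 0.
Proof.
have := bT.1 (-1) 0 0 z; rewrite scaler0 addr0 mulN1r addrC subrr; exact.
Qed.

Lemma op_comb N (c : nat -> R[i]) (g : nat -> V) z :
  ip (T (\sum_(k < N) c k *: g k)) z = \sum_(k < N) c k * ip (T (g k)) z.
Proof.
elim: N => [|N IH]; first by rewrite !big_ord0 op0.
by rewrite !big_ord_recr/= addrC bT.1 IH addrC.
Qed.

Lemma nsq_op_comb N (c : nat -> R[i]) (g : nat -> V) :
  nsq (T (\sum_(k < N) c k *: g k)) = nsq (\sum_(k < N) c k *: T (g k)).
Proof.
apply: (nsq_congr Hip); rewrite /sqn (ipBl Hip) op_comb (ip_suml Hip).
under [X in _ - X]eq_bigr do rewrite (ipZl Hip).
by rewrite subrr.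
Qed.

Lemma op_cvg (u : nat -> V) x :
  (fun N => nsq (x - u N)) @ \oo --> (0 : R) ->
  (fun N => nsq (T x - T (u N))) @ \oo --> (0 : R).
Proof.
move=> h; have [M bM] := bT.2.
have h2 : (fun N => `|M| * nsq (x - u N)) @ \oo --> (0 : R).
  by rewrite -[X in _ --> X](mulr0 `|M|); apply: cvgM => //; exact: cvg_cst.
apply: (squeeze_cvgr _ (@cvg_cst _ _ _ _ _) h2).
apply: nearW => N; rewrite nsq_ge0//=.
have -> : nsq (T x - T (u N)) = nsq (T (x - u N)).
  apply: (nsq_congr Hip); rewrite /sqn !(ipBl Hip).
  have -> : x - u N = -1 *: u N + x by rewrite scaleN1r addrC.
  by rewrite bT.1 (_ : _ - _ = 0)//; ring.
apply: (le_trans (bM _)); rewrite ler_wpM2r ?nsq_ge0//; exact: ler_norm.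
Qed.

Lemma eigenbasis_diagonalizes e mu : complete_orthonormal ip e ->
  (forall j, nsq (T (e j) - (mu j)%:C *: e j) = 0) -> diagonalizes ip T e mu.
Proof.
move=> ce ev x j; have [oe cve] := ce.
apply: (ip_cvg_eq Hip (op_cvg (cve x))).
exists j.+1 => //= N jN.
rewrite (op_comb _ (fun k => ip x (e k))) (bigD1 (Ordinal jN))//= big1 ?addr0.
  have := ip_null Hip (e j) (ev j); rewrite (ipBl Hip) => /subr0_eq ->.
  by rewrite (ipZl Hip) oe eqxx mulr1 mulrC.
move=> k; rewrite -val_eqE/= => kj.
have := ip_null Hip (e j) (ev k); rewrite (ipBl Hip) => /subr0_eq ->.
by rewrite (ipZl Hip) oe (negbTE kj) !mulr0.
Qed.

(** Finite combinations of the [b k] satisfy the bound by [nsq_comb_le], and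
    continuity of [T] extends it to their limits. *)
Lemma hilbert_schmidt_bound b (S : R) : complete_orthonormal ip b ->
  (forall N, \sum_(k < N) nsq (T (b k)) <= S) ->
  forall x, nsq (T x) <= S * nsq x.
Proof.
move=> [ob cb] hS x.
have S0 : 0 <= S by have := hS 0%N; rewrite big_ord0.
have bnd : 0 <= S * nsq x by rewrite mulr_ge0 ?nsq_ge0.
suff H : nsq (T x) ^+ 2 <= S * nsq x * nsq (T x).
  have [->//|n0] := eqVneq (nsq (T x)) 0.
  have np : 0 < nsq (T x) by rewrite lt_neqAle eq_sym n0 nsq_ge0.
  by rewrite -(ler_pM2r np) -expr2.
have bnd2 : 0 <= S * nsq x * nsq (T x) by rewrite mulr_ge0 ?nsq_ge0.
rewrite -[leRHS]sqr_sqrtr// ler_sqr ?nnegrE ?nsq_ge0 ?sqrtr_ge0//.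
have h := Re_ip_cvg Hip (z := T x) (op_cvg (cb x)).
apply: ler_cvg_to h (@cvg_cst _ _ _ _ _) _; apply: nearW => N.
apply: (le_trans (ler_norm _)); apply: (le_trans (le_Re_cmod _)).
rewrite -(@ger0_norm _ (cmod _)) ?cmod_ge0// -sqrtr_sqr ler_sqrt//.
apply: (le_trans (cauchy_schwarz Hip _ _)); rewrite ler_wpM2r ?nsq_ge0//.
rewrite (nsq_op_comb _ (fun k => ip x (b k))).
apply: (le_trans (nsq_comb_le Hip N (fun k => ip x (b k)) (fun k => T (b k)))).
rewrite mulrC.
apply: ler_pM => //; first by apply: sumr_ge0 => k _; exact: nsq_ge0.
  by apply: sumr_ge0 => k _; exact: sqr_ge0.
exact: (bessel Hip).
Qed.

(** Weyl's inequality with a vanishing perturbation. *)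
Lemma ranked_eigenvalue_unique m e e' mu mu' :
  complete_orthonormal ip e -> (forall j, nsq (T (e j) - (mu j)%:C *: e j) = 0) ->
  (forall i j, (i <= m)%N -> (i <= j)%N -> mu j <= mu i) ->
  complete_orthonormal ip e' -> (forall j, nsq (T (e' j) - (mu' j)%:C *: e' j) = 0) ->
  (forall i j, (i <= m)%N -> (i <= j)%N -> mu' j <= mu' i) ->
  mu m = mu' m.
Proof.
move=> ce ev mon ce' ev' mon'; apply/eqP; rewrite -subr_eq0 -normr_le0.
apply: (weyl Hip (lexx 0) ce (eigenbasis_diagonalizes ce ev) mon
  ce' (eigenbasis_diagonalizes ce' ev') mon').
by move=> x; rewrite subrr /sqn (ip0l Hip) expr0n/= mul0r.
Qed.

End OneOperator.
End BoundedOperators.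

(** * Measurability and Fubini theorems for complex functions *)

Section ComplexMeasurability.
Context d (T : measurableType d) (R : realType).
Implicit Types (D : set T) (f g : T -> R[i]).

Lemma cmeasurable_ext D f g : (forall x, D x -> f x = g x) ->
  cmeasurable_fun D f -> cmeasurable_fun D g.
Proof.
move=> fg [h1 h2]; split; [move: h1|move: h2]; apply: eq_measurable_fun => x;
  by rewrite inE => /fg ->.
Qed.

Lemma cmeasurable_cst D (c : R[i]) : cmeasurable_fun D (fun=> c).
Proof. by split; exact: measurable_cst. Qed.

Lemma cmeasurableD D f g : cmeasurable_fun D f -> cmeasurable_fun D g ->
  cmeasurable_fun D (fun x => f x + g x).
Proof.
move=> [f1 f2] [g1 g2]; split; under eq_fun do rewrite ?ReD ?ImD;
  exact: measurable_funD.
Qed.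

Lemma cmeasurableM D f g : cmeasurable_fun D f -> cmeasurable_fun D g ->
  cmeasurable_fun D (fun x => f x * g x).
Proof.
move=> [f1 f2] [g1 g2]; split; under eq_fun do rewrite ?ReM ?ImM.
  by apply: measurable_funB; exact: measurable_funM.
by apply: measurable_funD; exact: measurable_funM.
Qed.

Lemma cmeasurableJ D f : cmeasurable_fun D f -> cmeasurable_fun D (fun x => (f x)^*).
Proof.
move=> [f1 f2]; split; under eq_fun do rewrite ?ReJ ?ImJ; first exact: f1.
exact: measurable_funN.
Qed.

Lemma cmeasurableB D f g : cmeasurable_fun D f -> cmeasurable_fun D g ->
  cmeasurable_fun D (fun x => f x - g x).
Proof.
move=> [f1 f2] [g1 g2]; split; under eq_fun do rewrite ?ReD ?ImD ?ReN ?ImN;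
  exact: measurable_funB.
Qed.

Lemma cmeasurable_sum D (I : Type) (r : seq I) (F : I -> T -> R[i]) :
  (forall i, cmeasurable_fun D (F i)) ->
  cmeasurable_fun D (fun x => \sum_(i <- r) F i x).
Proof.
move=> mF; elim: r => [|i r IH].
  by under [X in cmeasurable_fun _ X]eq_fun do rewrite big_nil; exact: cmeasurable_cst.
by under [X in cmeasurable_fun _ X]eq_fun do rewrite big_cons; exact: cmeasurableD.
Qed.

Lemma measurable_sqr_cmod D f : cmeasurable_fun D f ->
  measurable_fun D (fun x => cmod (f x) ^+ 2).
Proof.
move=> [f1 f2]; under eq_fun do rewrite sqr_cmod.
by apply: measurable_funD; exact: measurable_funX.
Qed.

Lemma measurable_EFin_sqr_cmod D f : cmeasurable_fun D f ->
  measurable_fun D (fun x => (cmod (f x) ^+ 2)%:E).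
Proof. by move=> /measurable_sqr_cmod h; exact/measurable_EFinP. Qed.

End ComplexMeasurability.

Lemma cmeasurable_comp d1 d2 (T1 : measurableType d1) (T2 : measurableType d2)
    (R : realType) (D1 : set T1) (D2 : set T2) (f : T2 -> R[i]) (g : T1 -> T2) :
  measurable D2 -> (forall x, D1 x -> D2 (g x)) -> measurable_fun D1 g ->
  cmeasurable_fun D2 f -> cmeasurable_fun D1 (fun x => f (g x)).
Proof.
move=> mD2 D12 mg [f1 f2]; split.
  by apply: (measurable_comp mD2 _ f1 mg) => _ [x /D12 ? <-].
by apply: (measurable_comp mD2 _ f2 mg) => _ [x /D12 ? <-].
Qed.

Section ProductDomains.
Context d1 d2 d3 (T1 : measurableType d1) (T2 : measurableType d2)
  (T3 : measurableType d3) (R : realType).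
Variables (D1 : set T1) (D2 : set T2) (D3 : set T3).
Hypotheses (mD1 : measurable D1) (mD2 : measurable D2) (mD3 : measurable D3).

Lemma measurable_fun_swap (f : T1 * T2 -> T3) :
  measurable_fun (D1 `*` D2) f ->
  measurable_fun (D2 `*` D1) (fun z : T2 * T1 => f (z.2, z.1)).
Proof.
move=> mf; have mg : measurable_fun (D2 `*` D1) (fun z : T2 * T1 => (z.2, z.1)).
  by apply: measurable_funTS; exact: measurable_swap.
apply: (measurable_comp (F := D1 `*` D2) _ _ mf mg); first exact: measurableX.
by move=> _ [[? ?] [? ?] <-].
Qed.

Lemma cmeasurable_drop_first (f : T2 * T3 -> R[i]) :
  cmeasurable_fun (D2 `*` D3) f ->
  cmeasurable_fun (D1 `*` D2 `*` D3) (fun z : T1 * T2 * T3 => f (z.1.2, z.2)).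
Proof.
apply: (cmeasurable_comp (g := fun z : T1 * T2 * T3 => (z.1.2, z.2))).
- exact: measurableX.
- by move=> [[? ?] ?] [[]].
- apply: measurable_funTS; apply: measurable_fun_pair; last exact: measurable_snd.
  by apply: measurableT_comp => //; exact: measurable_fst.
Qed.

End ProductDomains.

Lemma cmeasurable_swap d1 d2 (T1 : measurableType d1) (T2 : measurableType d2)
    (R : realType) (D1 : set T1) (D2 : set T2) (f : T1 * T2 -> R[i]) :
  measurable D1 -> measurable D2 -> cmeasurable_fun (D1 `*` D2) f ->
  cmeasurable_fun (D2 `*` D1) (fun z : T2 * T1 => f (z.2, z.1)).
Proof.
move=> mD1 mD2 [f1 f2].
by split; [exact: (measurable_fun_swap mD1 mD2 f1)|exact: (measurable_fun_swap mD1 mD2 f2)].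
Qed.

Section ParametricIntegrals.
Context d1 d2 (T1 : measurableType d1) (T2 : measurableType d2) (R : realType).
Variable mu : {sigma_finite_measure set T2 -> \bar R}.
Variables (D1 : set T1) (D2 : set T2).
Hypotheses (mD1 : measurable D1) (mD2 : measurable D2).

Lemma restrict_slice (f : T1 * T2 -> \bar R) x : D1 x ->
  (\int[mu]_y (f \_ (D1 `*` D2)) (x, y) = \int[mu]_(y in D2) f (x, y))%E.
Proof.
move=> Dx; rewrite [RHS]integral_mkcond; apply: eq_integral => y _.
rewrite !patchE; congr (if _ then _ else _).
by apply/idP/idP; rewrite !inE/=; [case|].
Qed.

Lemma measurable_parametric_integral (f : T1 * T2 -> \bar R) :
  measurable_fun (D1 `*` D2) f -> (forall z, (D1 `*` D2) z -> 0 <= f z)%E ->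
  measurable_fun D1 (fun x => \int[mu]_(y in D2) f (x, y))%E.
Proof.
move=> mf f0.
have mF : measurable_fun setT (fubini_F mu (f \_ (D1 `*` D2))).
  apply: measurable_fun_fubini_tonelli_F; last exact: erestrict_ge0.
  by apply/(measurable_restrictT _ _).1 => //; exact: measurableX.
apply: (@eq_measurable_fun _ _ _ _ D1 (fubini_F mu (f \_ (D1 `*` D2)))) => [x|].
  by rewrite inE => Dx; rewrite /fubini_F restrict_slice.
exact: measurable_funTS.
Qed.

Lemma measurable_parametric_Rintegral (f : T1 * T2 -> R) :
  measurable_fun (D1 `*` D2) f ->
  measurable_fun D1 (fun x => Rintegral mu D2 (fun y => f (x, y))).
Proof.
move=> mf.
have mE : measurable_fun (D1 `*` D2) (EFin \o f) by exact/measurable_EFinP.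
rewrite /Rintegral; under eq_fun => x do rewrite integralE.
apply: (measurableT_comp (f := fine)) => //; apply: emeasurable_funB.
  under eq_fun do rewrite (funepos_comp (EFin \o f) (pair _)) /=.
  by apply: measurable_parametric_integral => //; exact: measurable_funepos.
under eq_fun do rewrite (funeneg_comp (EFin \o f) (pair _)) /=.
by apply: measurable_parametric_integral => //; exact: measurable_funeneg.
Qed.

Lemma cmeasurable_parametric (f : T1 * T2 -> R[i]) :
  cmeasurable_fun (D1 `*` D2) f ->
  cmeasurable_fun D1 (fun x => cintegral mu D2 (fun y => f (x, y))).
Proof.
move=> [f1 f2]; split => /=.
  exact: (measurable_parametric_Rintegral f1).
exact: (measurable_parametric_Rintegral f2).
Qed.

End ParametricIntegrals.

Section FubiniOnRectangles.
Context d1 d2 (T1 : measurableType d1) (T2 : measurableType d2) (R : realType).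
Variable m1 : {sigma_finite_measure set T1 -> \bar R}.
Variable m2 : {sigma_finite_measure set T2 -> \bar R}.
Variables (D1 : set T1) (D2 : set T2).
Hypotheses (mD1 : measurable D1) (mD2 : measurable D2).

Lemma restrict_slice2 (f : T1 * T2 -> \bar R) y : D2 y ->
  (\int[m1]_x (f \_ (D1 `*` D2)) (x, y) = \int[m1]_(x in D1) f (x, y))%E.
Proof.
move=> Dx; rewrite [RHS]integral_mkcond; apply: eq_integral => x _.
rewrite !patchE; congr (if _ then _ else _).
by apply/idP/idP; rewrite !inE/=; [case|].
Qed.

Lemma restrict_iterated12 (f : T1 * T2 -> \bar R) :
  (\int[m1]_x \int[m2]_y (f \_ (D1 `*` D2)) (x, y) =
   \int[m1]_(x in D1) \int[m2]_(y in D2) f (x, y))%E.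
Proof.
rewrite [RHS]integral_mkcond; apply: eq_integral => x _; rewrite patchE.
case: ifPn => [|xD]; first by rewrite inE => Dx; exact: restrict_slice.
apply: integral0_eq => y _; rewrite patchE ifF//; apply/negbTE.
by apply: contra xD; rewrite !inE => -[].
Qed.

Lemma restrict_iterated21 (f : T1 * T2 -> \bar R) :
  (\int[m2]_y \int[m1]_x (f \_ (D1 `*` D2)) (x, y) =
   \int[m2]_(y in D2) \int[m1]_(x in D1) f (x, y))%E.
Proof.
rewrite [RHS]integral_mkcond; apply: eq_integral => y _; rewrite patchE.
case: ifPn => [|yD]; first by rewrite inE => Dy; exact: restrict_slice2.
apply: integral0_eq => x _; rewrite patchE ifF//; apply/negbTE.
by apply: contra yD; rewrite !inE => -[].
Qed.

Lemma tonelli_rect (f : T1 * T2 -> \bar R) :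
  measurable_fun (D1 `*` D2) f -> (forall z, (D1 `*` D2) z -> 0 <= f z)%E ->
  (\int[m1]_(x in D1) \int[m2]_(y in D2) f (x, y) =
   \int[m2]_(y in D2) \int[m1]_(x in D1) f (x, y))%E.
Proof.
move=> mf f0; rewrite -restrict_iterated12 -restrict_iterated21.
apply: fubini_tonelli; last exact: erestrict_ge0.
by apply/(measurable_restrictT _ _).1 => //; exact: measurableX.
Qed.

(** Tonelli's theorem for the indicator of [N], whose iterated integral vanishes
    in one order. *)
Lemma ae_exchange (N : set (T1 * T2)) : measurable N ->
  (forall x, D1 x -> {ae m2, forall y, D2 y -> ~ N (x, y)}) ->
  {ae m2, forall y, D2 y -> {ae m1, forall x, D1 x -> ~ N (x, y)}}.
Proof.
move=> mN hN; pose f : T1 * T2 -> \bar R := fun z => (\1_N z)%:E.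
have mfT : measurable_fun setT f by apply/measurable_EFinP; exact: measurable_indic.
have mf : measurable_fun (D1 `*` D2) f by exact: measurable_funTS.
have f0 z : (0 <= f z)%E by rewrite lee_fin.
have mf2 : measurable_fun D2 (fun y => \int[m1]_(x in D1) f (x, y))%E.
  pose g (z : T2 * T1) := f (z.2, z.1).
  apply: (measurable_parametric_integral m1 mD2 mD1 (f := g)); last first.
    by move=> z _; exact: f0.
  exact: (measurable_fun_swap mD1 mD2 mf).
have : (\int[m2]_(y in D2) `|\int[m1]_(x in D1) f (x, y)| = 0)%E.
  transitivity (\int[m2]_(y in D2) \int[m1]_(x in D1) f (x, y))%E.
    by apply: eq_integral => y _; rewrite gee0_abs//; exact: integral_ge0.
  rewrite -tonelli_rect//; apply: integral0_eq => x Dx.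
  transitivity (\int[m2]_(y in D2) (cst 0 y : \bar R))%E; last exact: integral0.
  apply: ae_eq_integral => //.
    by apply: measurable_funTS; exact: (measurableT_comp mfT (pair1_measurable x)).
  apply: filterS (hN x Dx) => y /= h Dy; rewrite /f indicE memNset//.
  exact: h.
move=> /(ae_eq_integral_abs _ mD2 mf2).1; apply: filterS => y /= h Dy.
have : (\int[m1]_(x in D1) `|f (x, y)| = 0)%E.
  by rewrite -[RHS](h Dy); apply: eq_integral => x _; rewrite gee0_abs.
have mfy : measurable_fun D1 (fun x => f (x, y)).
  by apply: measurable_funTS; exact: (measurableT_comp mfT (pair2_measurable y)).
move=> /(ae_eq_integral_abs _ mD1 mfy).1; apply: filterS => x /= hx Dx Nxy.
by have := hx Dx; rewrite /f indicE mem_set//= => /eqP; rewrite eqe oner_eq0.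
Qed.

(** The bound [g] replaces the modulus of [f] so that integrability can be checked
    on a function whose iterated integral is explicit. *)
Lemma fubini_rect (f : T1 * T2 -> R) (g : T1 * T2 -> \bar R) :
  measurable_fun (D1 `*` D2) f -> measurable_fun (D1 `*` D2) g ->
  (forall z, (D1 `*` D2) z -> `|f z|%:E <= g z)%E ->
  (\int[m1]_(x in D1) \int[m2]_(y in D2) g (x, y) < +oo)%E ->
  Rintegral m1 D1 (fun x => Rintegral m2 D2 (fun y => f (x, y))) =
  Rintegral m2 D2 (fun y => Rintegral m1 D1 (fun x => f (x, y))).
Proof.
move=> mf mg fg goo.
pose h := (EFin \o f) \_ (D1 `*` D2).
have mh : measurable_fun setT h.
  apply/(measurable_restrictT _ _).1; first exact: measurableX.
  exact/measurable_EFinP.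
have ih : (m1 \x m2)%E.-integrable setT h.
  apply/integrable12ltyP => //; apply: le_lt_trans goo.
  rewrite -restrict_iterated12; apply: ge0_le_integral => //.
  - by move=> x _; exact: integral_ge0.
  - apply: (measurable_fun_fubini_tonelli_F (abse \o h)) => //=.
    exact: measurableT_comp.
  - apply: (measurable_fun_fubini_tonelli_F (g \_ _)).
      by apply/(measurable_restrictT _ _).1 => //; exact: measurableX.
    by apply: erestrict_ge0 => z /fg; exact: le_trans.
  - move=> x _; apply: ge0_le_integral => //.
    + exact/measurableT_comp/measurableT_comp.
    + apply: measurableT_comp => //.
      by apply/(measurable_restrictT _ _).1 => //; exact: measurableX.
    + move=> y _; rewrite /h !patchE; case: ifPn; last by rewrite abse0.
      by rewrite inE => /fg.
have E1 : Rintegral m1 D1 (fun x => Rintegral m2 D2 (fun y => f (x, y))) =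
    fine (\int[m1]_x \int[m2]_y h (x, y))%E.
  rewrite Rintegral_mkcond /Rintegral; congr fine; apply: ae_eq_integral => //.
  - apply/measurable_EFinP/(measurable_restrictT _ _).1 => //.
    exact: measurable_parametric_Rintegral.
  - exact: (measurable_fubini_F ih).
  have := ae_integrable1 ih; apply: filterS => x ix _ /=.
  rewrite patchE; case: ifPn => [|xD].
    rewrite inE => Dx; rewrite (restrict_slice m2 D2 (EFin \o f) Dx) fineK//.
    by rewrite -(restrict_slice m2 D2 (EFin \o f) Dx); exact: integrable_fin_num.
  rewrite integral0_eq// => y _; rewrite /h patchE ifF//; apply/negbTE.
  by apply: contra xD; rewrite !inE => -[].
have E2 : Rintegral m2 D2 (fun y => Rintegral m1 D1 (fun x => f (x, y))) =
    fine (\int[m2]_y \int[m1]_x h (x, y))%E.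
  rewrite Rintegral_mkcond /Rintegral; congr fine; apply: ae_eq_integral => //.
  - apply/measurable_EFinP/(measurable_restrictT _ _).1 => //.
    pose f' (z : T2 * T1) := f (z.2, z.1).
    apply: (measurable_parametric_Rintegral m1 mD2 mD1 (f := f')) => //.
    exact: (measurable_fun_swap mD1 mD2 mf).
  - exact: (measurable_fubini_G ih).
  have := ae_integrable2 ih; apply: filterS => y iy _ /=.
  rewrite patchE; case: ifPn => [|yD].
    rewrite inE => Dy; rewrite (restrict_slice2 (EFin \o f) Dy) fineK//.
    by rewrite -(restrict_slice2 (EFin \o f) Dy); exact: integrable_fin_num.
  rewrite integral0_eq// => x _; rewrite /h patchE ifF//; apply/negbTE.
  by apply: contra yD; rewrite !inE => -[].
by rewrite E1 E2; congr fine; exact: Fubini.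
Qed.

Lemma cfubini_rect (f : T1 * T2 -> R[i]) (g : T1 * T2 -> \bar R) :
  cmeasurable_fun (D1 `*` D2) f -> measurable_fun (D1 `*` D2) g ->
  (forall z, (D1 `*` D2) z -> (cmod (f z))%:E <= g z)%E ->
  (\int[m1]_(x in D1) \int[m2]_(y in D2) g (x, y) < +oo)%E ->
  cintegral m1 D1 (fun x => cintegral m2 D2 (fun y => f (x, y))) =
  cintegral m2 D2 (fun y => cintegral m1 D1 (fun x => f (x, y))).
Proof.
move=> [f1 f2] mg fg goo; apply: complex_eqP => /=.
  apply: (fubini_rect f1 mg) goo => z /fg; apply: le_trans.
  by rewrite lee_fin le_Re_cmod.
apply: (fubini_rect f2 mg) goo => z /fg; apply: le_trans.
by rewrite lee_fin le_Im_cmod.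
Qed.

End FubiniOnRectangles.

(** * Spaces of square-integrable functions *)

Section ComplexIntegral.
Context d (T : measurableType d) (R : realType).
Variables (mu : {measure set T -> \bar R}) (D : set T).
Hypothesis mD : measurable D.
Implicit Types (f g : T -> R[i]).

Definition cintegrable f : Prop :=
  mu.-integrable D (EFin \o (fun x => complex.Re (f x))) /\
  mu.-integrable D (EFin \o (fun x => complex.Im (f x))).

Lemma eq_cintegral f g : (forall x, D x -> f x = g x) ->
  cintegral mu D f = cintegral mu D g.
Proof.
move=> fg; congr (_ +i* _); apply: eq_Rintegral => x; rewrite inE => Dx;
  by rewrite fg.
Qed.

Lemma ae_eq_cintegral f g : cmeasurable_fun D f -> cmeasurable_fun D g ->
  {ae mu, forall x, D x -> f x = g x} -> cintegral mu D f = cintegral mu D g.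
Proof.
move=> [f1 f2] [g1 g2] fg; congr (_ +i* _); rewrite /Rintegral; congr fine;
  (apply: ae_eq_integral => //; try exact/measurable_EFinP);
  by apply: filterS fg => x h /h ->.
Qed.

Lemma cintegral_lin (a : R[i]) f g : cintegrable f -> cintegrable g ->
  cintegral mu D (fun x => a * f x + g x) = a * cintegral mu D f + cintegral mu D g.
Proof.
move=> [f1 f2] [g1 g2].
have i1 k : mu.-integrable D (EFin \o (fun x => k * complex.Re (f x))).
  exact: (integrableZl mD k f1).
have i2 k : mu.-integrable D (EFin \o (fun x => k * complex.Im (f x))).
  exact: (integrableZl mD k f2).
apply: complex_eqP; rewrite /= ?ReD ?ImD ?ReM ?ImM /=.
  under eq_Rintegral do rewrite ReD ReM.
  rewrite RintegralD//; last exact: (integrableB mD (i1 _) (i2 _)).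
  by rewrite RintegralB// !RintegralZl.
under eq_Rintegral do rewrite ImD ImM.
rewrite RintegralD//; last exact: (integrableD mD (i2 _) (i1 _)).
by rewrite RintegralD// !RintegralZl.
Qed.

Lemma cintegralJ f : cintegrable f ->
  cintegral mu D (fun x => (f x)^*) = (cintegral mu D f)^*.
Proof.
move=> [f1 f2]; apply: complex_eqP; rewrite ?ReJ ?ImJ /=.
  by apply: eq_Rintegral => x _; rewrite ReJ.
under eq_Rintegral do rewrite ImJ -mulN1r.
by rewrite RintegralZl// mulN1r.
Qed.

Lemma cintegrable0 : cintegrable (fun=> 0).
Proof. by split; apply: integrable0. Qed.

Lemma cintegralZ (a : R[i]) f : cintegrable f ->
  cintegral mu D (fun x => a * f x) = a * cintegral mu D f.
Proof.
move=> fi; have := cintegral_lin a fi cintegrable0.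
have -> : cintegral mu D (fun=> 0) = 0.
  by apply: complex_eqP => /=; rewrite /Rintegral integral0.
by rewrite addr0 => <-; apply: eq_cintegral => x _; rewrite addr0.
Qed.

Definition sqint f : \bar R := (\int[mu]_(x in D) (cmod (f x) ^+ 2)%:E)%E.

Definition in_L2 f : Prop := cmeasurable_fun D f /\ (sqint f < +oo)%E.

Definition cprod f g : R[i] := cintegral mu D (fun x => f x * (g x)^*).

Lemma sqint_ge0 f : (0 <= sqint f)%E.
Proof. by apply: integral_ge0 => x _; rewrite lee_fin sqr_ge0. Qed.

Lemma eq_sqint f g : (forall x, D x -> f x = g x) -> sqint f = sqint g.
Proof. by move=> fg; apply: eq_integral => x; rewrite inE => Dx; rewrite fg. Qed.

Lemma ae_eq_sqint f g : cmeasurable_fun D f -> cmeasurable_fun D g ->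
  {ae mu, forall x, D x -> f x = g x} -> sqint f = sqint g.
Proof.
move=> mf mg fg; apply: ae_eq_integral => //; try exact: measurable_EFin_sqr_cmod.
by apply: filterS fg => x h /h ->.
Qed.

Lemma sqintZ (a : R[i]) f : cmeasurable_fun D f ->
  sqint (fun x => a * f x) = ((cmod a ^+ 2)%:E * sqint f)%E.
Proof.
move=> mf; rewrite /sqint; under eq_integral do rewrite cmodM exprMn EFinM.
rewrite ge0_integralZl_EFin ?sqr_ge0//; last exact: measurable_EFin_sqr_cmod.
by move=> x _; rewrite lee_fin sqr_ge0.
Qed.

Lemma sqintD_le f g : cmeasurable_fun D f -> cmeasurable_fun D g ->
  (sqint (fun x => f x + g x)%R <= 2%:E * sqint f + 2%:E * sqint g)%E.
Proof.
move=> mf mg; rewrite /sqint.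
rewrite -!ge0_integralZl_EFin//; try (by move=> x _; rewrite lee_fin sqr_ge0);
  try exact: measurable_EFin_sqr_cmod.
rewrite -ge0_integralD//; last 4 first.
- by move=> x _; rewrite -EFinM lee_fin mulr_ge0 ?sqr_ge0.
- by apply: measurable_funeM; exact: measurable_EFin_sqr_cmod.
- by move=> x _; rewrite -EFinM lee_fin mulr_ge0 ?sqr_ge0.
- by apply: measurable_funeM; exact: measurable_EFin_sqr_cmod.
apply: ge0_le_integral => //.
- by move=> x _; rewrite lee_fin sqr_ge0.
- by apply: measurable_EFin_sqr_cmod; exact: cmeasurableD.
- by apply: emeasurable_funD; apply: measurable_funeM; exact: measurable_EFin_sqr_cmod.
- by move=> x _; rewrite -!EFinM -EFinD lee_fin sqr_cmodD.
Qed.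

Lemma in_L2_lin (a : R[i]) f g : in_L2 f -> in_L2 g ->
  in_L2 (fun x => a * f x + g x).
Proof.
move=> [mf fi] [mg gi].
have maf : cmeasurable_fun D (fun x => a * f x).
  by apply: cmeasurableM => //; exact: cmeasurable_cst.
split; first exact: cmeasurableD.
apply: (le_lt_trans (sqintD_le maf mg)).
rewrite sqintZ//; apply: lte_add_pinfty; apply: lte_mul_pinfty => //.
by apply: lte_mul_pinfty => //; rewrite lee_fin sqr_ge0.
Qed.

Lemma in_L20 : in_L2 (fun=> 0).
Proof.
split; first exact: cmeasurable_cst.
by rewrite /sqint integral0_eq// => x _; rewrite cmod0 expr0n.
Qed.

Lemma in_L2B f g : in_L2 f -> in_L2 g -> in_L2 (fun x => f x - g x).
Proof.
move=> fi gi; have := in_L2_lin (-1) gi fi.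
by congr in_L2; apply/funext => x; rewrite mulN1r addrC.
Qed.

Lemma in_L2J f : in_L2 f -> in_L2 (fun x => (f x)^*).
Proof.
move=> [mf fi]; split; first exact: cmeasurableJ.
by rewrite /sqint; under eq_integral do rewrite cmodJ.
Qed.

Lemma cintegrable_dom f (g : T -> \bar R) : cmeasurable_fun D f ->
  mu.-integrable D g -> (forall x, D x -> (cmod (f x))%:E <= `|g x|)%E ->
  cintegrable f.
Proof.
move=> [f1 f2] ig fg; split; apply: (le_integrable mD _ _ ig) => /=;
  try exact/measurable_EFinP; move=> x Dx; apply: le_trans (fg x Dx);
  by rewrite lee_fin ?le_Re_cmod ?le_Im_cmod.
Qed.

Lemma cmodM_le (x y : R[i]) : cmod (x * y) <= cmod x ^+ 2 + cmod y ^+ 2.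
Proof.
by rewrite cmodM; have := sqr_ge0 (cmod x - cmod y);
  have := sqr_ge0 (cmod x); have := sqr_ge0 (cmod y); rewrite sqrrB; lra.
Qed.

Lemma integrable_sqr_cmod f : in_L2 f ->
  mu.-integrable D (EFin \o (fun x => cmod (f x) ^+ 2)).
Proof.
move=> [mf fi]; apply/integrableP; split; first exact: measurable_EFin_sqr_cmod.
by under eq_integral do rewrite gee0_abs ?lee_fin ?sqr_ge0//.
Qed.

Lemma cintegrableM f g : in_L2 f -> in_L2 g -> cintegrable (fun x => f x * g x).
Proof.
move=> fi gi.
apply: (cintegrable_dom _ (integrableD mD (integrable_sqr_cmod fi)
  (integrable_sqr_cmod gi))).
  by apply: cmeasurableM; [case: fi|case: gi].
move=> x _; rewrite /= lee_fin; apply: (le_trans (cmodM_le _ _)).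
exact: ler_norm.
Qed.

Lemma cprod_self f : in_L2 f -> ((complex.Re (cprod f f))%:E = sqint f)%E.
Proof.
move=> fi; rewrite /cprod /cintegral /= /Rintegral.
under eq_integral do rewrite mulcJ /=.
by rewrite fineK//; have := integrable_fin_num mD (integrable_sqr_cmod fi).
Qed.

(** The proof that [D] is measurable is an argument of the predicate because
    closure under addition rests on it. *)
Definition L2pred of measurable D : {pred T -> R[i]} := fun f => `[< in_L2 f >].

Lemma L2_submod_closed : submod_closed (L2pred mD).
Proof.
split; first by apply/asboolP; exact: in_L20.
by move=> a f g /asboolP fi /asboolP gi; apply/asboolP; exact: in_L2_lin.
Qed.

HB.instance Definition _ := GRing.isSubmodClosed.Build R[i] (T -> R[i])
  (L2pred mD) L2_submod_closed.

Record L2 := MkL2 { L2val : T -> R[i]; _ : L2val \in L2pred mD }.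

HB.instance Definition _ := [isSub for L2val].
HB.instance Definition _ := [Choice of L2 by <:].
HB.instance Definition _ := [SubChoice_isSubLmodule of L2 by <:].

Lemma L2P (f : L2) : in_L2 (L2val f). Proof. by case: f => f fL /=; exact: (asboolW fL). Qed.

Definition toL2 f (fi : in_L2 f) : L2 := MkL2 (asboolT fi).

Definition L2ip (f g : L2) : R[i] := cprod (L2val f) (L2val g).

Lemma L2_semi_inner : semi_inner L2ip.
Proof.
split=> [a f g h|f g|f].
- rewrite /L2ip /cprod -cintegral_lin; last 2 first.
    exact: cintegrableM (L2P f) (in_L2J (L2P h)).
    exact: cintegrableM (L2P g) (in_L2J (L2P h)).
  by apply: eq_cintegral => x _; rewrite /= mulrDl mulrA.
- rewrite /L2ip /cprod -cintegralJ; last exact: cintegrableM (L2P f) (in_L2J (L2P g)).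
  by apply: eq_cintegral => x _; rewrite rmorphM/= conjCK mulrC.
- by rewrite -lee_fin cprod_self ?sqint_ge0//; exact: L2P.
Qed.

Lemma L2_nsq (f : L2) : ((sqn L2ip f)%:E = sqint (L2val f))%E.
Proof. by rewrite -cprod_self//; exact: L2P. Qed.

Lemma L2val_sum (I : Type) (r : seq I) (F : I -> L2) x :
  L2val (\sum_(i <- r) F i) x = \sum_(i <- r) L2val (F i) x.
Proof. by elim/big_rec2 : _ => //= i y z _ <-. Qed.

End ComplexIntegral.

Section SquareIntegrableSlices.
Context d1 d2 (T1 : measurableType d1) (T2 : measurableType d2) (R : realType).
Variable m1 : {sigma_finite_measure set T1 -> \bar R}.
Variable m2 : {sigma_finite_measure set T2 -> \bar R}.
Variables (D1 : set T1) (D2 : set T2).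
Hypotheses (mD1 : measurable D1) (mD2 : measurable D2).
Variable f : T1 -> T2 -> R[i].
Hypothesis mf : cmeasurable_fun (D1 `*` D2) (fun z : T1 * T2 => f z.1 z.2).

Let mswap := cmeasurable_swap mD1 mD2 mf.
Let q (z : T2 * T1) := (cmod (f z.2 z.1) ^+ 2)%:E.

Let mq : measurable_fun (D2 `*` D1) q.
Proof. exact: measurable_EFin_sqr_cmod mswap. Qed.

Let q0 z : (D2 `*` D1) z -> (0 <= q z)%E.
Proof. by rewrite lee_fin sqr_ge0. Qed.

Lemma sqint_exchange :
  (\int[m2]_(y in D2) sqint m1 D1 (f ^~ y) = \int[m1]_(x in D1) sqint m2 D2 (f x))%E.
Proof. exact: (tonelli_rect m2 m1 mD2 mD1 mq q0). Qed.

Lemma measurable_sqint_slices : measurable_fun D2 (fun y => sqint m1 D1 (f ^~ y)).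
Proof. exact: (measurable_parametric_integral m1 mD2 mD1 mq q0). Qed.

Lemma ae_slice_in_L2 : (\int[m1]_(x in D1) sqint m2 D2 (f x) < +oo)%E ->
  {ae m2, forall y, D2 y -> in_L2 m1 D1 (f ^~ y)}.
Proof.
move=> ffin; have iq : m2.-integrable D2 (fun y => sqint m1 D1 (f ^~ y)).
  apply/integrableP; split; first exact: measurable_sqint_slices.
  have -> : (\int[m2]_(y in D2) `|sqint m1 D1 (f ^~ y)| =
      \int[m2]_(y in D2) sqint m1 D1 (f ^~ y))%E.
    by apply: eq_integral => y _; rewrite gee0_abs// sqint_ge0.
  by rewrite sqint_exchange.
have := integrable_ae mD2 iq; apply: filterS => y h Dy; split.
  exact: (cmeasurable_comp (measurableX mD2 mD1) _ (measurable_funTS (pair1_measurable y)) mswap).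
by have := h Dy; rewrite ge0_fin_numE// sqint_ge0.
Qed.

End SquareIntegrableSlices.

(** * Operators on the unit interval *)

Section UnitInterval.
Variable R : realType.
Local Notation leb := (@lebesgue_measure R).
Local Notation I := (@unitI R).
Implicit Types (x y : R -> R[i]) (T : oper R).

Lemma measurable_unitI : measurable (I : set (measurableTypeR R)). Proof. exact: measurable_itv. Qed.

(** For the bare set function, which carries no measure structure in statements
    that hold almost everywhere. *)
#[export] Instance ae_lebesgue_filter : Filter (almost_everywhere leb).
Proof. exact: (ae_filter_ringOfSetsType [the measure _ _ of leb]). Qed.

(** The two sides carry the same sigma-algebra under two display names. *)
Lemma inHE x : inH x = in_L2 leb I x. Proof. by []. Qed.

Definition Hsp : lmodType R[i] := L2 leb measurable_unitI.

Definition ipH : Hsp -> Hsp -> R[i] := @L2ip _ _ _ leb _ measurable_unitI.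

Lemma ipH_semi_inner : semi_inner ipH. Proof. exact: L2_semi_inner. Qed.

Local Notation Hip := ipH_semi_inner.

Definition toH x (hx : inH x) : Hsp :=
  @toL2 _ _ _ leb _ measurable_unitI x (eq_ind _ id hx _ (inHE x)).

Definition ofH (x : Hsp) : R -> R[i] := L2val x.

Lemma ofHP (x : Hsp) : inH (ofH x). Proof. by rewrite inHE; exact: L2P. Qed.

Lemma nsqH (x : Hsp) : ((sqn ipH x)%:E = sqnormH (ofH x))%E.
Proof. exact: L2_nsq. Qed.

Lemma inner_ipH x y (hx : inH x) (hy : inH y) : inner x y = ipH (toH hx) (toH hy).
Proof. by []. Qed.

Lemma sqnormH_fin x : inH x -> sqnormH x = (complex.Re (inner x x))%:E.
Proof. by move=> hx; rewrite -(nsqH (toH hx)). Qed.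

Lemma inH_sub x y : inH x -> inH y -> inH (fun u => x u - y u).
Proof. by rewrite !inHE => hx hy; exact: (in_L2B measurable_unitI hx hy). Qed.

Lemma eqH_nsq (x y : Hsp) : eqH (ofH x) (ofH y) -> sqn ipH (x - y) = 0.
Proof.
move=> xy; apply: EFin_inj; rewrite nsqH.
have -> : sqnormH (ofH (x - y)) = sqnormH (fun=> 0).
  apply: (ae_eq_sqint measurable_unitI); first by case: (L2P (x - y)).
    exact: cmeasurable_cst.
  apply: filterS xy => u h /h e.
  by rewrite -[LHS]/(ofH x u - ofH y u) e subrr.
by apply: integral0_eq => u _; rewrite cmod0 expr0n.
Qed.

Section Operator.
Variables (T : oper R) (hT : bounded_linear T).

Definition opH (x : Hsp) : Hsp :=
  toH (let: And3 h _ _ := hT in h _ (ofHP x)).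

Lemma opH_bounded : bounded_op ipH opH.
Proof.
case: (hT) => h1 h2 [M hM]; split.
  move=> a x y z.
  have e := h2 a (ofH x) (ofH y) (ofHP x) (ofHP y).
  have n0 : sqn ipH (opH (a *: x + y) - (a *: opH x + opH y)) = 0 by exact: eqH_nsq.
  by have := ip_null Hip z n0; rewrite (ipBl Hip) (ip_lin Hip) => /subr0_eq.
exists (M ^+ 2) => x; rewrite -lee_fin EFinM !nsqH; exact: hM (ofHP x).
Qed.

(** Almost everywhere equality in the unit interval becomes a null difference. *)
Lemma opH_eigen l (f : Hsp) : eigenfunction T l (ofH f) ->
  sqn ipH (opH f - l%:C *: f) = 0.
Proof. by move=> [_ _ h]; exact: eqH_nsq. Qed.

End Operator.

Lemma ofH_sum (J : Type) (r : seq J) (F : J -> Hsp) u :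
  ofH (\sum_(i <- r) F i) u = \sum_(i <- r) ofH (F i) u.
Proof. exact: L2val_sum. Qed.

Definition basisH (b : nat -> R -> R[i]) (hb : orthonormal_basis b) (k : nat) : Hsp :=
  toH (hb.1.1 k).

Lemma basisH_complete b (hb : orthonormal_basis b) :
  complete_orthonormal ipH (basisH hb).
Proof.
split=> [i j|x]; first exact: hb.1.2.
have h := hb.2 (ofH x) (ofHP x).
set u := fun N => _.
suff -> : u = fine \o (fun N =>
    sqnormH (fun t => ofH x t - \sum_(k < N) inner (ofH x) (b k) * b k t)).
  exact: fine_cvg h.
apply/funext => N; rewrite /= -[LHS]/(fine (u N)%:E) nsqH; congr fine.
apply: eq_integral => t _; congr ((cmod _ ^+ 2)%:E).
rewrite -[LHS]/(ofH x t - ofH (\sum_(k < N) _) t); congr (_ - _).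
exact: ofH_sum.
Qed.

(** The square undoes the root in the definition also when the sum is infinite. *)
Lemma sqr_hsnorm b T : ((hsnorm b T) ^+ 2 = \sum_(0 <= k <oo) sqnormH (T (b k)))%E.
Proof.
rewrite /hsnorm; set s := (\sum_(_ <= _ <oo) _)%E.
have : (0 <= s)%E by apply: nneseries_ge0 => k _ _; exact: sqint_ge0.
case: s => [r|_|//].
  rewrite lee_fin => r0.
  by rewrite poweR_EFin expe2 -EFinM -expr2 powR12_sqrt// sqr_sqrtr.
by rewrite poweRyr// expe2.
Qed.

End UnitInterval.

(** * Stability of oriented eigenfunctions *)

Section Stability.
Variable R : realType.
Local Notation leb := (@lebesgue_measure R).
Local Notation I := (@unitI R).
Implicit Types (x y : R -> R[i]) (T : oper R).
Local Notation Hip := (ipH_semi_inner R).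

Lemma nth_eigenvalueE T (hT : bounded_linear T) m l : nth_eigenvalue T m l ->
  exists e mu, [/\ complete_orthonormal (@ipH R) e,
    forall j, sqn (@ipH R) (opH hT (e j) - (mu j)%:C *: e j) = 0,
    forall i j, (i <= m)%N -> (i <= j)%N -> mu j <= mu i & mu m = l].
Proof.
move=> [e [mu [he ev mon mum]]]; exists (basisH he), mu; split => //.
  exact: basisH_complete.
by move=> j; apply: opH_eigen; exact: ev.
Qed.

Lemma nth_eigenvalue_unique T (hT : bounded_linear T) k m e mu l :
  complete_orthonormal (@ipH R) e ->
  (forall j, sqn (@ipH R) (opH hT (e j) - (mu j)%:C *: e j) = 0) ->
  (forall i j, (i <= m)%N -> (i <= j)%N -> mu j <= mu i) -> (k <= m)%N ->
  nth_eigenvalue T k l -> mu k = l.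
Proof.
move=> ce ev mon km /(nth_eigenvalueE hT)[e' [mu' [ce' ev' mon' <-]]].
apply: (ranked_eigenvalue_unique Hip (opH_bounded hT) ce ev _ ce' ev' mon').
by move=> i j ik; apply: mon; exact: leq_trans km.
Qed.

(** Up to rank [m.+1] the eigenvalues are those of one eigenbasis sorted that
    far; all later ones lie below, so the neighbours of rank [m] realize the
    distance to the rest of the spectrum. *)
Lemma spectral_gap T (hT : bounded_linear T) m (lam : nat -> R) :
  (forall k, nth_eigenvalue T k (lam k)) -> alpha lam m <> 0 ->
  exists e mu, [/\ complete_orthonormal (@ipH R) e,
    forall j, sqn (@ipH R) (opH hT (e j) - (mu j)%:C *: e j) = 0,
    forall i j, (i <= m)%N -> (i <= j)%N -> mu j <= mu i, mu m = lam m &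
    0 < alpha lam m /\ forall j : nat, j != m -> alpha lam m <= `|mu j - mu m|].
Proof.
move=> hlam a0.
have [e [mu [ce ev mon _]]] := nth_eigenvalueE hT (hlam m.+1).
have muE k : (k <= m.+1)%N -> mu k = lam k.
  by move=> km; exact: (nth_eigenvalue_unique ce ev mon km).
exists e, mu; split => //; [by move=> i j im; apply: mon; exact: ltnW|exact: muE|].
have hgt j : (m < j)%N -> lam m - lam m.+1 <= `|mu j - mu m|.
  move=> mj; rewrite -!muE// distrC; apply: le_trans (ler_norm _).
  by rewrite lerD2l lerN2; apply: mon.
have hlt k j : m = k.+1 -> (j < m)%N -> lam k - lam m <= `|mu j - mu m|.
  move=> mk jm; have jk : (j <= k)%N by rewrite -ltnS -mk.
  have km : (k <= m.+1)%N by rewrite mk ltnW.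
  rewrite -!muE//; apply: le_trans (ler_norm _).
  by rewrite lerD2r; apply: mon => //; exact: ltnW (leqW jm).
have dec k : (k <= m)%N -> 0 <= lam k - lam k.+1.
  by move=> km; rewrite subr_ge0 -!muE ?(leq_trans km)//; apply: mon => //;
    exact: leq_trans km _.
split.
  rewrite lt_neqAle eq_sym (introN eqP a0)//=.
  case: (m) dec => [|k] dec /=; first exact: dec.
  by rewrite le_min !dec.
move=> j; rewrite neq_ltn => /orP[jm|mj].
  case: (m) jm hlt {hgt dec a0 hlam ev mon muE} => [//|k] jm hlt /=.
  by rewrite ge_min; rewrite hlt.
apply: le_trans (hgt _ mj).
by case: (m) => [|k] //=; rewrite ge_min lexx orbT.
Qed.

(** [eigenvector_stability] in the space of square-integrable functions, with the
    Hilbert-Schmidt norm as a bound of the operator norm. *)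
Theorem eigenfunction_stability b F lam m phi v : orthonormal_basis b ->
  hilbert_schmidt b F -> (forall k, nth_eigenvalue F k (lam k)) ->
  unit_eigenfunction F (lam m) phi -> alpha lam m <> 0 -> inH v ->
  0 <= inner phi v -> inner phi v <> 0 ->
  exists C : R, 0 < C /\ forall G f, hilbert_schmidt b G ->
    nth_unit_eigenfunction G m f -> 0 <= inner f v ->
    (sqnormH (fun u => f u - phi u)%R <= C%:E * hsnorm b (op_sub F G) ^+ 2)%E.
Proof.
move=> hb [bF _] hlam [ephi phi1] a0 hv.
have [iphi _ _] := ephi.
rewrite (inner_ipH iphi hv); set p := toH iphi; set w := toH hv.
move=> p0 pn0.
have [e [mu [ce ev mon mum [ap gap]]]] := spectral_gap bF hlam a0.
have pv : ipH p w = (complex.Re (ipH p w))%:C.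
  by apply: complex_eqP => //=; move: p0; rewrite lecE => /andP[/eqP].
have k0 : 0 < complex.Re (ipH p w).
  rewrite lt_neqAle eq_sym; move: p0; rewrite lecE => /andP[_ ->]; rewrite andbT.
  by apply/eqP => h; apply: pn0; rewrite pv h.
move: (complex.Re _) pv k0 => kappa pv k0.
set C := 16 * (1 + 2 * (sqn (@ipH R) w / kappa ^+ 2)) / alpha lam m ^+ 2.
have C0 : 0 < C.
  rewrite divr_gt0 ?exprn_gt0// mulr_gt0// ltr_pwDl// mulr_ge0//.
  by rewrite divr_ge0 ?sqr_ge0//; exact: nsq_ge0 Hip _.
exists C; split => //.
move=> G f [bG _] [l' hl' [ef f1]]; have [jf _ _] := ef.
rewrite (inner_ipH jf hv); set q := toH jf => qv.
have [e' [mu' [ce' ev' mon' mum']]] := nth_eigenvalueE bG hl'.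
rewrite sqr_hsnorm.
have : (0 <= \sum_(0 <= k <oo) sqnormH (op_sub F G (b k)))%E.
  by apply: nneseries_ge0 => k _ _; exact: sqint_ge0.
have hN N : ((\sum_(k < N) sqn (@ipH R) (opH bF (basisH hb k) - opH bG (basisH hb k)))%:E
    <= \sum_(0 <= k <oo) sqnormH (op_sub F G (b k)))%E.
  have -> : (\sum_(k < N) sqn (@ipH R) (opH bF (basisH hb k) - opH bG (basisH hb k)))%:E
      = (\sum_(0 <= k < N) sqnormH (op_sub F G (b k)))%E.
    by rewrite big_mkord -sumEFin; apply: eq_bigr => k _; exact: nsqH.
  by apply: (nneseries_lim_ge (P := xpredT)) => k _ _; exact: sqint_ge0.
case: (\sum_(_ <= _ <oo) _)%E hN => [s|hN _|//]; last first.
  by rewrite gt0_muley ?lte_fin ?leey.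
rewrite lee_fin => hs s0.
have hbound := hilbert_schmidt_bound Hip (bounded_op_sub Hip (opH_bounded bF) (opH_bounded bG))
  (basisH_complete hb) hs.
rewrite -(nsqH (q - p)) -EFinM lee_fin.
rewrite -(sqr_sqrtr s0).
have diag := eigenbasis_diagonalizes Hip (opH_bounded bF) ce ev.
have diag' := eigenbasis_diagonalizes Hip (opH_bounded bG) ce' ev'.
apply: (eigenvector_stability Hip ce diag mon ap gap _ _ k0 pv ce' diag' mon') => //.
- by rewrite mum; exact: opH_eigen.
- by apply: EFin_inj; rewrite nsqH.
- by rewrite mum'; exact: opH_eigen.
- by apply: EFin_inj; rewrite nsqH.
- by move=> x; rewrite sqr_sqrtr.
Qed.

End Stability.

(** * Domination by a vanishing mean and slowly growing indices *)

Section NonnegativeLimits.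
Variable R : realType.

Lemma cvge0_near (u : nat -> \bar R) : u @ \oo --> 0%E ->
  forall e : R, 0 < e -> \forall n \near \oo, (u n <= e%:E)%E.
Proof.
move=> /fine_cvgP[ufin /cvgrPdist_le ulim] e e0.
have := ulim _ e0; near_simpl => h; near=> n.
have un : u n \is a fin_num by near: n.
rewrite -(fineK un) lee_fin; apply: (le_trans (ler_norm _)).
by rewrite -normrN -sub0r; near: n.
Unshelve. all: by end_near. Qed.

Lemma near_cvge0 (u : nat -> \bar R) : (forall n, 0 <= u n)%E ->
  (forall e : R, 0 < e -> \forall n \near \oo, (u n <= e%:E)%E) -> u @ \oo --> 0%E.
Proof.
move=> u0 H; apply/fine_cvgP; split.
  by have := H 1 ltr01; apply: filterS => n un; rewrite ge0_fin_numE// (le_lt_trans un)// ltry.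
apply/cvgrPdist_le => /= e e0; have := H _ e0; apply: filterS => n un.
have ufin : u n \is a fin_num by rewrite ge0_fin_numE// (le_lt_trans un)// ltry.
by rewrite sub0r normrN ger0_norm ?fine_ge0// -lee_fin fineK.
Qed.

(** [L n] is the largest admissible index below [n].  As [dn] vanishes in the
    limit, every fixed index is admissible from some [n] on. *)
Lemma slow_index (dn : nat -> \bar R) : dn @ \oo --> 0%E ->
  exists L : nat -> nat, [/\ L @ \oo --> \oo,
    \forall n \near \oo, (2 * L n < n)%N &
    \forall n \near \oo, (((L n).+1%:R ^+ 4)%:E * dn n <= 1)%E].
Proof.
move=> /cvge0_near hd.
pose ok n k := (2 * k < n)%N && (((k.+1)%:R ^+ 4)%:E * dn n <= 1)%E.
have ok_near k : \forall n \near \oo, ok n k.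
  have e0 : 0 < ((k.+1)%:R ^+ 4 : R)^-1 by rewrite invr_gt0 exprn_gt0.
  near=> n; apply/andP; split; first by near: n; exact: nbhs_infty_gt.
  have : (dn n <= ((k.+1)%:R ^+ 4 : R)^-1%:E)%E by near: n; exact: hd.
  move=> /(lee_wpmul2l (x := ((k.+1)%:R ^+ 4)%:E)) h.
  apply: (le_trans (h _)); first by rewrite lee_fin exprn_ge0.
  by rewrite -EFinM divff// gt_eqF// exprn_gt0.
pose L n := \max_(k < n | ok n k) k.
have Lok n : ok n 0%N -> ok n (L n).
  by move=> ok0; apply: (big_ind (ok n)) => // i j oi oj; rewrite /maxn; case: ifP.
exists L; split.
- apply/cvgnyPge => k; near=> n.
  have okk : ok n k by near: n.
  have kn : (k < n)%N by case/andP: okk => h _; apply: leq_ltn_trans h; rewrite leq_pmull.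
  exact: (@leq_bigmax_cond _ (fun j : 'I_n => ok n j) (fun j => j : nat) (Ordinal kn)).
- near=> n; suff /andP[] : ok n (L n) by [].
  by apply: Lok; near: n; exact: ok_near.
- near=> n; suff /andP[] : ok n (L n) by [].
  by apply: Lok; near: n; exact: ok_near.
Unshelve. all: by end_near. Qed.

End NonnegativeLimits.

(** The constant [C] may depend on the point in a nonmeasurable way, so it cannot
    be cut at a level.  The sets [E K] where [K.+1] is not a valid constant for
    some [n] are measurable, and they decrease to a null set.  Off [E K] the
    integral of [A n] is at most [K.+1] times that of [G n], and on [E K] it is
    at most [M] times the measure of [E K]. *)
Lemma integral_dominated_cvg0 d (T : measurableType d) (R : realType)
    (mu : {measure set T -> \bar R}) (D : set T) (M : R)
    (A G : nat -> T -> \bar R) : measurable D -> (mu D < +oo)%E -> 0 <= M ->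
  (forall n, measurable_fun D (A n)) -> (forall n, measurable_fun D (G n)) ->
  (forall n x, D x -> 0 <= A n x)%E -> (forall n x, D x -> 0 <= G n x)%E ->
  (forall n x, D x -> A n x <= M%:E)%E ->
  {ae mu, forall x, D x -> exists C : R, forall n, (A n x <= C%:E * G n x)%E} ->
  (fun n => \int[mu]_(x in D) G n x)%E @ \oo --> 0%E ->
  (fun n => \int[mu]_(x in D) A n x)%E @ \oo --> 0%E.
Proof.
move=> mD muD M0 mA mG A0 G0 AM hC hG.
pose E K := \bigcup_n (D `&` [set x | (K.+1%:R%:E * G n x < A n x)%E]).
have mE K : measurable (E K).
  apply: bigcupT_measurable => n; apply: measurable_lte => //.
  exact: measurable_funeM.
have ED K : E K `<=` D by move=> x [n _ []].
have nE : nonincreasing_seq E.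
  move=> i j ij; apply/subsetPset => x [n _ [Dx /= h]]; exists n => //; split => //=.
  apply: le_lt_trans h; apply: lee_wpmul2r; first exact: G0.
  by rewrite lee_fin ler_nat.
have muE0 : mu (\bigcap_K E K) = 0%E.
  case: hC => N [mN N0 hN]; apply/eqP; rewrite eq_le measure_ge0 andbT -N0.
  apply: le_measure; rewrite ?inE//; first exact: bigcapT_measurable.
  apply: subset_trans hN => x hx /= hh.
  have [C hCx] := hh (ED 0%N _ (hx 0%N I)).
  have [n _ [Dx /=]] := hx (Num.Def.trunc `|C|) I; rewrite ltNge => /negP; apply.
  apply: (le_trans (hCx n)); apply: lee_wpmul2r; first exact: G0.
  rewrite lee_fin; apply: (le_trans (ler_norm _)); apply: ltW.
  exact: truncnS_gt.
have hE : (fun K => mu (E K)) @ \oo --> 0%E.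
  rewrite -muE0; apply: nonincreasing_cvg_mu => //; last exact: bigcapT_measurable.
  by apply: le_lt_trans muD; apply: le_measure; rewrite ?inE//; exact: ED.
apply: near_cvge0 => [n|e e0]; first by apply: integral_ge0 => x; exact: A0.
have M1 : 0 < M + 1 by rewrite ltr_wpDl.
have e2 : 0 < e / 2 / (M + 1) by rewrite !divr_gt0.
have [K _ /(_ K (leqnn _)) hK] := cvge0_near hE e2.
have e3 : 0 < e / 2 / K.+1%:R by rewrite !divr_gt0.
have := cvge0_near hG e3; apply: filterS => n hn.
have m1 : measurable_fun D (fun x => (\1_(E K) x)%:E : \bar R).
  by apply/measurable_EFinP; exact: measurable_indic.
apply: (@le_trans _ _ (\int[mu]_(x in D) (M%:E * (\1_(E K) x)%:E + K.+1%:R%:E * G n x))%E).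
  apply: ge0_le_integral => //; first exact: A0.
    by apply: emeasurable_funD; exact: measurable_funeM.
  move=> x Dx; rewrite indicE; have [xE|xE] := boolP (x \in E K).
    by rewrite mule1; apply: (le_trans (AM n x Dx)); rewrite leeDl// mule_ge0// G0.
  rewrite mule0 add0e leNgt; apply/negP => h; move/negP: xE; apply.
  by rewrite inE; exists n.
rewrite ge0_integralD//; last 4 first.
- by move=> x _; rewrite mule_ge0// lee_fin.
- exact: measurable_funeM.
- by move=> x Dx; rewrite mule_ge0// G0.
- exact: measurable_funeM.
rewrite !ge0_integralZl_EFin//; last exact: G0.
rewrite integral_indic// setIidl; last exact: ED.
rewrite (splitr e) EFinD; apply: leeD.
  apply: (@le_trans _ _ ((M + 1)%:E * mu (E K))%E).
    by apply: lee_wpmul2r => //; rewrite lee_fin lerDl.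
  have := lee_wpmul2l (x := (M + 1)%:E) _ hK; rewrite lee_fin => /(_ (ltW M1)).
  by rewrite -EFinM mulrC divfK// gt_eqF.
have := lee_wpmul2l (x := K.+1%:R%:E) _ hn; rewrite lee_fin => /(_ (ler0n _ _)).
by rewrite -EFinM mulrC divfK.
Qed.

(** * Measurability of filters and covariance kernels *)

Section ParametrizedMeasurability.
Variable R : realType.
Local Notation leb := (@lebesgue_measure R).
Local Notation I := (@unitI R).
Local Notation mI := (@measurable_unitI R).
Local Notation RR := (measurableTypeR R).

Lemma measurable_freqI : measurable (@freqI R : set RR).
Proof. exact: measurable_itv. Qed.

Lemma cmeasurable_slice d1 d2 (T1 : measurableType d1) (T2 : measurableType d2)
    (D1 : set T1) (D2 : set T2) (f : T1 * T2 -> R[i]) x :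
  measurable D1 -> measurable D2 -> D1 x ->
  cmeasurable_fun (D1 `*` D2) f -> cmeasurable_fun D2 (fun y => f (x, y)).
Proof.
move=> mD1 mD2 Dx; apply: (cmeasurable_comp (g := pair x)) => //.
  exact: measurableX.
by apply: measurable_funTS; exact: pair1_measurable.
Qed.

Section OverT.
Context d (T : measurableType d) (D : set T).
Hypothesis mD : measurable D.
Implicit Types f g : T -> R -> R[i].

Lemma measurable_inner f g :
  cmeasurable_fun (D `*` I) (fun p : T * RR => f p.1 p.2) ->
  cmeasurable_fun (D `*` I) (fun p : T * RR => g p.1 p.2) ->
  cmeasurable_fun D (fun t => inner (f t) (g t)).
Proof.
move=> mf mg; have h := cmeasurableM mf (cmeasurableJ mg).
exact: (cmeasurable_parametric leb mD mI h).
Qed.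

Lemma measurable_sqnormH f :
  cmeasurable_fun (D `*` I) (fun p : T * RR => f p.1 p.2) ->
  measurable_fun D (fun t => sqnormH (f t)).
Proof.
move=> mf; have h := measurable_EFin_sqr_cmod mf.
have h0 (z : T * RR) : (D `*` I) z -> (0 <= (cmod (f z.1 z.2) ^+ 2)%:E)%E.
  by rewrite lee_fin sqr_ge0.
exact: (measurable_parametric_integral leb mD mI h h0).
Qed.

Lemma measurable_snd_comp (g : R -> R[i]) : cmeasurable_fun (I : set RR) g ->
  cmeasurable_fun (D `*` I) (fun p : T * RR => g p.2).
Proof.
move=> mg; apply: (cmeasurable_comp mI _ _ mg) => [[x y] []//|].
by apply: measurable_funTS; exact: measurable_snd.
Qed.

Lemma measurable_fst_comp (h : T -> R[i]) : cmeasurable_fun D h ->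
  cmeasurable_fun (D `*` I) (fun p : T * RR => h p.1).
Proof.
move=> mh; apply: (cmeasurable_comp mD _ _ mh) => [[x y] []//|].
by apply: measurable_funTS; exact: measurable_fst.
Qed.

End OverT.

Lemma measurable_cis (D : set RR) (k : R) : cmeasurable_fun D (fun s : RR => cis (k * s)).
Proof.
have h : measurable_fun D (fun s : RR => k * s : RR).
  by apply: measurable_funM; [exact: measurable_cst|exact: measurable_id].
split.
  apply: (measurableT_comp (f := @cos R)) h.
  by apply: continuous_measurable_fun; exact: continuous_cos.
apply: (measurableT_comp (f := @sin R)) h.
by apply: continuous_measurable_fun; exact: continuous_sin.
Qed.

Lemma measurable_filter_coef d (T : measurableType d) (D : set T)
    (f : T -> R -> R -> R[i]) l : measurable D ->
  cmeasurable_fun (D `*` @freqI R `*` I)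
    (fun q : T * RR * RR => f q.1.1 q.1.2 q.2) ->
  cmeasurable_fun (D `*` I) (fun p : T * RR => filter_coef (f p.1) l p.2).
Proof.
move=> mD mf; apply: cmeasurableM; first exact: cmeasurable_cst.
pose g (z : (T * RR) * RR) := f z.1.1 z.2 z.1.2 * cis (- (l%:~R * z.2)).
apply: (cmeasurable_parametric leb (measurableX mD mI) measurable_freqI (f := g)).
apply: cmeasurableM.
  apply: (cmeasurable_comp (g := fun z : (T * RR) * RR => ((z.1.1, z.2), z.1.2)) _ _ _ mf).
  - by apply: measurableX => //; [apply: measurableX => //; exact: measurable_freqI|exact: mI].
  - by move=> [[w u] s] [[/= ? ?] ?].
  - apply: measurable_funTS; apply: measurable_fun_pair => /=.
      apply: measurable_fun_pair => /=; last exact: measurable_snd.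
      by apply: measurableT_comp => //; exact: measurable_fst.
    exact: measurableT_comp.
have mc : cmeasurable_fun setT (fun s : RR => cis (- (l%:~R * s))).
  have := measurable_cis setT (- l%:~R); apply: cmeasurable_ext => s _.
  by rewrite mulNr.
apply: (cmeasurable_comp (g := fun z : (T * RR) * RR => z.2) measurableT _ _ mc) => //.
by apply: measurable_funTS; exact: measurable_snd.
Qed.

End ParametrizedMeasurability.

Section ProcessMeasurability.
Variables (R : realType) (d : measure_display) (Omega : measurableType d).
Variable P : probability Omega R.
Variable X : int -> Omega -> R -> R[i].
Local Notation leb := (@lebesgue_measure R).
Local Notation I := (@unitI R).
Local Notation mI := (@measurable_unitI R).
Local Notation RR := (measurableTypeR R).
Local Notation freq := (@freqI R : set RR).
Hypothesis hX : H_process X.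

Lemma measurable_process t :
  cmeasurable_fun (setT `*` I) (fun p : Omega * RR => X t p.1 p.2).
Proof. by case: (hX t). Qed.

Lemma measurable_cov_kernel s t :
  cmeasurable_fun (I `*` I) (fun p : RR * RR => cov_kernel P X s t p.1 p.2).
Proof.
pose g (z : (RR * RR) * Omega) := X s z.2 z.1.1 * (X t z.2 z.1.2)^*.
have mII := measurableX mI mI.
apply: (cmeasurable_parametric P mII measurableT (f := g)).
apply: cmeasurableM; last apply: cmeasurableJ.
  apply: (cmeasurable_comp (g := fun z : (RR * RR) * Omega => (z.2, z.1.1)) _ _ _
    (measurable_process s)).
  - exact: (measurableX measurableT mI).
  - by move=> [[u v] w] [[/= ? ?] ?].
  - apply: measurable_funTS; apply: measurable_fun_pair => /=; first exact: measurable_snd.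
    by apply: measurableT_comp => //; exact: measurable_fst.
apply: (cmeasurable_comp (g := fun z : (RR * RR) * Omega => (z.2, z.1.2)) _ _ _
  (measurable_process t)).
- exact: (measurableX measurableT mI).
- by move=> [[u v] w] [[/= ? ?] ?].
- apply: measurable_funTS; apply: measurable_fun_pair => /=; first exact: measurable_snd.
  by apply: measurableT_comp => //; exact: measurable_fst.
Qed.

Lemma measurable_autocov_op h x : inH x ->
  cmeasurable_fun (I : set RR) (autocov_op P X h x).
Proof.
rewrite inHE => -[mx _].
have h1 := cmeasurableM (measurable_cov_kernel h 0) (measurable_snd_comp (I : set RR) mx).
exact: (cmeasurable_parametric leb mI mI h1).
Qed.

Lemma measurable_spectral_partial_sum N x : inH x ->
  cmeasurable_fun (freq `*` I)
    (fun p : RR * RR => spectral_partial_sum P X N p.1 x p.2).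
Proof.
move=> hx; apply: cmeasurableM; first exact: cmeasurable_cst.
apply: cmeasurable_sum => k; set h := (_ - _)%R.
apply: cmeasurableM.
  have := measurable_cis freq (- h%:~R).
  move/(measurable_fst_comp (@measurable_freqI R)); apply: cmeasurable_ext => -[th u] _ /=.
  by rewrite mulNr.
exact: (measurable_snd_comp freq (measurable_autocov_op h hx)).
Qed.

End ProcessMeasurability.

(** * Coordinates of the spectral density operator *)

Section Coordinates.
Variable R : realType.
Local Notation leb := (@lebesgue_measure R).
Local Notation I := (@unitI R).
Local Notation Hip := (ipH_semi_inner R).
Variables (b : nat -> R -> R[i]) (hb : orthonormal_basis b).
Implicit Types (x y : R -> R[i]) (T : oper R).

Lemma inner_sub x y z : inH x -> inH y -> inH z ->
  inner (fun u => x u - y u) z = inner x z - inner y z.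
Proof. by move=> hx hy hz; exact: (ipBl Hip (toH hx) (toH hy) (toH hz)). Qed.

Lemma sqr_cmod_inner_le x y : inH x -> inH y ->
  ((cmod (inner x y) ^+ 2)%:E <= sqnormH x * sqnormH y)%E.
Proof.
move=> hx hy; have := cauchy_schwarz Hip (toH hx) (toH hy).
by rewrite -lee_fin [X in (_ <= X)%E]EFinM !nsqH.
Qed.

Lemma sqnormH_series x : inH x ->
  (sqnormH x = \sum_(0 <= k <oo) (cmod (inner x (b k)) ^+ 2)%:E)%E.
Proof.
move=> hx; apply/esym/cvg_lim => //.
have h := parseval Hip (x := toH hx) (basisH_complete hb).
rewrite -(nsqH (toH hx)).
have -> : (fun n => \sum_(0 <= k < n) (cmod (inner x (b k)) ^+ 2)%:E)%E =
    EFin \o (fun N => \sum_(k < N) cmod (ipH (toH hx) (basisH hb k)) ^+ 2).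
  by apply/funext => N /=; rewrite big_mkord sumEFin.
by apply: cvg_EFin => //; exact: nearW.
Qed.

Lemma sqnormH_ge0 x : (0 <= sqnormH x)%E. Proof. exact: sqint_ge0. Qed.

Lemma hsnorm_ge0 T : (0 <= hsnorm b T)%E. Proof. exact: poweR_ge0. Qed.

Lemma sqnormH_le_hsnorm T k : (sqnormH (T (b k)) <= hsnorm b T ^+ 2)%E.
Proof.
rewrite sqr_hsnorm.
have h := @nneseries_lim_ge R (fun k => sqnormH (T (b k))) xpredT 0 k.+1.
apply: le_trans (h _); last by move=> *; exact: sqnormH_ge0.
rewrite big_nat_recr//= leeDr// sume_ge0// => i _; exact: sqnormH_ge0.
Qed.

(** Expresses the Hilbert-Schmidt distance by countably many coordinates, hence
    as a measurable function of the outcome and the frequency. *)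
Lemma sqr_hsnorm_coord S T : bounded_linear S -> bounded_linear T ->
  (hsnorm b (op_sub S T) ^+ 2 = \sum_(0 <= k <oo) \sum_(0 <= j <oo)
    (cmod (inner (S (b k)) (b j) - inner (T (b k)) (b j)) ^+ 2)%:E)%E.
Proof.
move=> [hS _ _] [hT _ _]; rewrite sqr_hsnorm; apply: eq_eseriesr => k _.
have ib := hb.1.1; rewrite sqnormH_series; last exact: inH_sub (hS _ _) (hT _ _).
by apply: eq_eseriesr => j _; rewrite inner_sub//; [exact: hS|exact: hT].
Qed.

End Coordinates.

Section SpectralDensityMeasurability.
Variables (R : realType) (d : measure_display) (Omega : measurableType d).
Variable P : probability Omega R.
Variable X : int -> Omega -> R -> R[i].
Local Notation leb := (@lebesgue_measure R).
Local Notation I := (@unitI R).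
Local Notation mI := (@measurable_unitI R).
Local Notation RR := (measurableTypeR R).
Local Notation freq := (@freqI R : set RR).
Hypothesis hX : H_process X.
Variables (b : nat -> R -> R[i]) (hb : orthonormal_basis b).
Variable F : R -> oper R.
Hypothesis hF : spectral_density_operator P b X F.

(** A pointwise limit of the coordinates of the partial sums of the defining
    series, which are parametric integrals of jointly measurable functions. *)
Lemma measurable_spectral_coord k j :
  cmeasurable_fun freq (fun theta : RR => inner (F theta (b k)) (b j)).
Proof.
have ib := hb.1.1.
pose S N (th : RR) := spectral_partial_sum P X N th (b k).
have mS N : cmeasurable_fun freq (fun th => inner (S N th) (b j)).
  apply: (measurable_inner (@measurable_freqI R)).
    exact: (measurable_spectral_partial_sum P hX N (ib k)).
  by apply: measurable_snd_comp; case: (ib j).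
have b1 : sqnormH (b j) = 1%E.
  by rewrite sqnormH_fin// hb.1.2 eqxx.
have key th : freq th -> forall e : R, 0 < e -> \forall N \near \oo,
    cmod (inner (F th (b k)) (b j) - inner (S N th) (b j)) <= e.
  move=> fth e e0; have [[[hFi _ _] _] hlim] := hF fth.
  have := cvge0_near hlim e0; apply: filterS => N hN.
  have iF := hFi _ (ib k).
  have dle : (sqnormH (fun u => F th (b k) u - S N th u)%R <= (e ^+ 2)%:E)%E.
    apply: (le_trans (sqnormH_le_hsnorm b (op_sub (F th) (spectral_partial_sum P X N th)) k)).
    rewrite expr2 EFinM expe2; exact: (lee_pmul (hsnorm_ge0 _ _) (hsnorm_ge0 _ _) hN hN).
  have mSN : cmeasurable_fun (I : set RR) (S N th).
    exact: (cmeasurable_slice (f := fun p : RR * RR => S N p.1 p.2) (@measurable_freqI R) mI fth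
      (measurable_spectral_partial_sum P hX N (ib k))).
  have iD : inH (fun u => F th (b k) u - S N th u).
    rewrite inHE; split; last by apply: le_lt_trans dle _; exact: ltry.
    by apply: cmeasurableB => //; move: iF; rewrite inHE => -[].
  have iS : inH (S N th).
    have := inH_sub iF iD; congr inH; apply/funext => u; ring.
  rewrite -inner_sub// -ler_sqr ?nnegrE ?cmod_ge0 ?(ltW e0)// -lee_fin.
  by apply: (le_trans (sqr_cmod_inner_le iD (ib j))); rewrite b1 mule1.
split.
  apply: (measurable_fun_cvg (h := fun N th => complex.Re (inner (S N th) (b j)))).
    by move=> N; case: (mS N).
  move=> th fth; apply/cvgrPdist_le => e e0; have := key th fth e e0.
  apply: filterS => N; apply: le_trans; rewrite -ReN -ReD; exact: le_Re_cmod.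
apply: (measurable_fun_cvg (h := fun N th => complex.Im (inner (S N th) (b j)))).
  by move=> N; case: (mS N).
move=> th fth; apply/cvgrPdist_le => e e0; have := key th fth e e0.
apply: filterS => N; apply: le_trans; rewrite -ImN -ImD; exact: le_Im_cmod.
Qed.

End SpectralDensityMeasurability.

(** * Exchange of expectations and integrals *)

Section ProductNull.
Context d1 d2 (T1 : measurableType d1) (T2 : measurableType d2) (R : realType).
Variable m1 : {sigma_finite_measure set T1 -> \bar R}.
Variable m2 : {sigma_finite_measure set T2 -> \bar R}.

Lemma ae_product_slices (Q : T1 * T2 -> Prop) : {ae (m1 \x m2)%E, forall z, Q z} ->
  {ae m1, forall x, {ae m2, forall y, Q (x, y)}}.
Proof.
move=> [N [mN N0 QN]].
have mphi := measurable_fun_xsection m2 mN.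
have : (\int[m1]_x `|m2 (xsection N x)| = 0)%E.
  by rewrite -[RHS]N0; apply: eq_integral => x _; rewrite gee0_abs.
move=> /(ae_eq_integral_abs _ measurableT mphi).1; apply: filterS => x /= /(_ I) h.
exists (xsection N x); split => //; first exact: measurable_xsection.
by move=> y /= hy; apply/xsectionP; apply: QN.
Qed.

End ProductNull.

Section Stationarity.
Variables (R : realType) (d : measure_display) (Omega : measurableType d).
Variable P : probability Omega R.
Local Notation leb := (@lebesgue_measure R).
Local Notation I := (@unitI R).
Local Notation mI := (@measurable_unitI R).
Local Notation RR := (measurableTypeR R).
Local Notation L2P := (in_L2 P setT).

(** Fubini's theorem, with the sum of the squared moduli of [Z * f] and [x] as an
    integrable bound.  The factor [f u] leaves the expectation only at almost
    every [u], where [x ^~ u] is square integrable. *)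
Lemma expectation_exchange (Z : Omega -> R[i]) (x : Omega -> R -> R[i]) (f : R -> R[i]) :
  L2P Z -> cmeasurable_fun (setT `*` I) (fun p : Omega * RR => x p.1 p.2) ->
  (forall w, inH (x w)) -> (\int[P]_w sqnormH (x w) < +oo)%E -> inH f ->
  cexpect P (fun w => Z w * cintegral leb I (fun u => x w u * f u)) =
  cintegral leb I (fun u => f u * cexpect P (fun w => Z w * x w u)).
Proof.
move=> hZ mx ix xfin hf; have [mZ Zfin] := hZ.
have hf2 : in_L2 leb I f by rewrite -inHE. have [mf ffin] := hf2.
pose F (z : Omega * RR) := (Z z.1 * f z.2) * x z.1 z.2.
have mF1 : cmeasurable_fun (setT `*` I) (fun z : Omega * RR => Z z.1 * f z.2).
  by apply: cmeasurableM; [exact: measurable_fst_comp|exact: measurable_snd_comp].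
have mF : cmeasurable_fun (setT `*` I) F by exact: cmeasurableM.
pose g (z : Omega * RR) := ((cmod (Z z.1 * f z.2) ^+ 2)%:E + (cmod (x z.1 z.2) ^+ 2)%:E)%E.
have mg : measurable_fun (setT `*` I) g.
  by apply: emeasurable_funD; exact: measurable_EFin_sqr_cmod.
have Fg z : (setT `*` I) z -> ((cmod (F z))%:E <= g z)%E.
  by rewrite /g -EFinD lee_fin => _; exact: cmodM_le.
have goo : (\int[P]_(w in setT) \int[leb]_(u in I) g (w, u) < +oo)%E.
  have -> : (\int[P]_(w in setT) \int[leb]_(u in I) g (w, u) =
      \int[P]_w ((cmod (Z w) ^+ 2)%:E * sqnormH f + sqnormH (x w)))%E.
    apply: eq_integral => w _; rewrite ge0_integralD; last 5 first.
    - exact: mI.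
    - by move=> *; rewrite lee_fin sqr_ge0.
    - apply: measurable_EFin_sqr_cmod.
      exact: (cmeasurableM (cmeasurable_cst _ (Z w)) mf).
    - by move=> *; rewrite lee_fin sqr_ge0.
    - apply: measurable_EFin_sqr_cmod.
      by have := ix w; rewrite inHE => -[].
    by congr (_ + _)%E; exact: (sqintZ leb mI (Z w) mf).
  rewrite ge0_integralD//; last 4 first.
  - by move=> w _; rewrite mule_ge0 ?sqnormH_ge0// lee_fin sqr_ge0.
  - under eq_fun do rewrite muleC.
    by apply: measurable_funeM; exact: measurable_EFin_sqr_cmod.
  - by move=> w _; exact: sqnormH_ge0.
  - exact: measurable_sqnormH.
  apply: lte_add_pinfty => //.
  under eq_integral do rewrite muleC.
  rewrite ge0_integralZl ?sqnormH_ge0//.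
  - by apply: lte_mul_pinfty; rewrite ?sqnormH_ge0// ge0_fin_numE ?sqnormH_ge0.
  - exact: measurable_EFin_sqr_cmod.
  - by move=> w _; rewrite lee_fin sqr_ge0.
have -> : cexpect P (fun w => Z w * cintegral leb I (fun u => x w u * f u)) =
    cintegral P setT (fun w => cintegral leb I (fun u => F (w, u))).
  apply: eq_cintegral => w _; rewrite -cintegralZ.
  - by apply: eq_cintegral => u _; rewrite /F /=; ring.
  - exact: mI.
  - by apply: cintegrableM => //; [exact: mI|rewrite -inHE].
rewrite (@cfubini_rect _ _ _ _ R P leb setT I measurableT mI F g mF mg Fg goo).
have swapF := cmeasurable_swap measurableT mI mF.
have mZx : cmeasurable_fun (setT `*` I) (fun z : Omega * RR => Z z.1 * x z.1 z.2).
  by apply: cmeasurableM => //; exact: measurable_fst_comp.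
have swapX := cmeasurable_swap measurableT mI mZx.
apply: ae_eq_cintegral.
- exact: mI.
- exact: (cmeasurable_parametric P mI measurableT swapF).
- by apply: cmeasurableM => //; exact: (cmeasurable_parametric P mI measurableT swapX).
have := @ae_slice_in_L2 _ _ _ _ R P leb setT I measurableT mI x mx xfin.
apply: filterS => u hu Iu; have hxu := hu Iu.
rewrite -cintegralZ//; last exact: cintegrableM.
by apply: eq_cintegral => w _; rewrite /F /=; ring.
Qed.

End Stationarity.

(** * Stationarity of the scores *)

Section StationaryScores.
Variables (R : realType) (d : measure_display) (Omega : measurableType d).
Variable P : probability Omega R.
Local Notation leb := (@lebesgue_measure R).
Local Notation I := (@unitI R).
Local Notation mI := (@measurable_unitI R).
Local Notation RR := (measurableTypeR R).
Local Notation LP := (L2 P (@measurableT _ Omega)).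
Local Notation ipP := (@L2ip _ _ _ P _ (@measurableT _ Omega)).
Local Notation HipP := (L2_semi_inner P (@measurableT _ Omega)).
Variable X : int -> Omega -> R -> R[i].
Hypothesis hX : weakly_stationary_zero_mean P X.
Implicit Types (f g : R -> R[i]) (s t : int).

Let hproc : H_process X. Proof. by case: hX. Qed.
Let Xfin t : (\int[P]_w sqnormH (X t w) < +oo)%E. Proof. by case: hX. Qed.
Let Xin t w : inH (X t w). Proof. by case: (hproc t). Qed.
Let mX t := measurable_process hproc t.

Lemma in_L2_inner (x : Omega -> R -> R[i]) f :
  cmeasurable_fun (setT `*` I) (fun p : Omega * RR => x p.1 p.2) ->
  (forall w, inH (x w)) -> (\int[P]_w sqnormH (x w) < +oo)%E -> inH f ->
  in_L2 P setT (fun w => inner (x w) f).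
Proof.
move=> mx ix xfin hf; have mf : cmeasurable_fun (I : set RR) f.
  by move: hf; rewrite inHE => -[].
have mi : cmeasurable_fun setT (fun w => inner (x w) f).
  by apply: measurable_inner => //; exact: measurable_snd_comp.
split => //; rewrite /sqint.
apply: (@le_lt_trans _ _ (\int[P]_w (sqnormH f * sqnormH (x w)))%E).
  apply: ge0_le_integral => //.
  - by move=> w _; rewrite lee_fin sqr_ge0.
  - exact: measurable_EFin_sqr_cmod.
  - by apply: measurable_funeM; exact: measurable_sqnormH.
  - by move=> w _; rewrite muleC; exact: sqr_cmod_inner_le.
rewrite ge0_integralZl ?sqnormH_ge0//.
- apply: lte_mul_pinfty => //; first exact: sqnormH_ge0.
  by rewrite ge0_fin_numE ?sqnormH_ge0//; move: hf => [].
- exact: measurable_sqnormH.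
- by move=> w _; exact: sqnormH_ge0.
Qed.

Lemma score_L2 t f : inH f -> in_L2 P setT (fun w => inner (X t w) f).
Proof. exact: in_L2_inner. Qed.

Lemma inH_J f : inH f -> inH (fun u => (f u)^*).
Proof. by rewrite !inHE; exact: in_L2J. Qed.

(** [expectation_exchange] once for each of the two scores.  This reduces the
    stationarity of the scores to that of the covariance kernel. *)
Lemma cross_moment s t f g : inH f -> inH g ->
  cexpect P (fun w => inner (X s w) f * (inner (X t w) g)^*) =
  cintegral leb I (fun u => (f u)^* *
    cintegral leb I (fun v => g v * cov_kernel P X s t u v)).
Proof.
move=> hf hg; have hfJ := inH_J hf.
have mfJ : cmeasurable_fun (I : set RR) (fun u => (f u)^*).
  by move: hfJ; rewrite inHE => -[].
have mg : cmeasurable_fun (I : set RR) g by move: hg; rewrite inHE => -[].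
pose Z w := (inner (X t w) g)^*.
have hZ : in_L2 P setT Z by apply: in_L2J; exact: score_L2.
have -> : cexpect P (fun w => inner (X s w) f * (inner (X t w) g)^*) =
    cexpect P (fun w => Z w * cintegral leb I (fun u => X s w u * (f u)^*)).
  by apply: eq_cintegral => w _; rewrite mulrC.
rewrite (expectation_exchange hZ (mX s) (Xin s) (Xfin s) hfJ).
have mXJ : cmeasurable_fun (setT `*` I) (fun p : Omega * RR => (X t p.1 p.2)^*).
  exact: cmeasurableJ.
have mZX : cmeasurable_fun (setT `*` I) (fun p : Omega * RR => Z p.1 * X s p.1 p.2).
  by apply: cmeasurableM => //; apply: measurable_fst_comp => //; case: hZ.
have swapZX := cmeasurable_swap measurableT mI mZX.
have mcov : cmeasurable_fun (I `*` I)
    (fun p : RR * RR => g p.2 * cov_kernel P X s t p.1 p.2).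
  by apply: cmeasurableM; [exact: measurable_snd_comp|exact: measurable_cov_kernel].
apply: ae_eq_cintegral.
- exact: mI.
- by apply: cmeasurableM => //; exact: (cmeasurable_parametric P mI measurableT swapZX).
- by apply: cmeasurableM => //; exact: (cmeasurable_parametric leb mI mI mcov).
have := @ae_slice_in_L2 _ _ _ _ R P leb setT I measurableT mI (X s) (mX s) (Xfin s).
apply: filterS => u hu Iu; have hxu := hu Iu.
apply: (congr1 (fun z => (f u)^* * z)).
have -> : cexpect P (fun w => Z w * X s w u) =
    cexpect P (fun w => X s w u * cintegral leb I (fun v => (X t w v)^* * g v)).
  apply: eq_cintegral => w _; rewrite mulrC; congr (_ * _).
  rewrite /Z /inner -cintegralJ.
  - by apply: eq_cintegral => v _; rewrite rmorphM/= conjCK.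
  - exact: mI.
  - apply: cintegrableM; first exact: mI.
      by rewrite -inHE; exact: Xin.
    by rewrite -inHE; exact: inH_J.
have XJin w : inH (fun v => (X t w v)^*) by apply: inH_J; exact: Xin.
have XJfin : (\int[P]_w sqnormH (fun v => (X t w v)^*)%R < +oo)%E.
  have E w : sqnormH (fun v => (X t w v)^*) = sqnormH (X t w).
    by apply: eq_integral => v _; rewrite cmodJ.
  by under eq_integral do rewrite E; exact: Xfin.
exact: (expectation_exchange hxu mXJ XJin XJfin hg).
Qed.

(** The kernels of two pairs of times agree at almost every pair of points, hence
    at almost every [v] for almost every [u]. *)
Lemma cross_moment_stationary t h f g : inH f -> inH g ->
  cexpect P (fun w => inner (X (t + h) w) f * (inner (X t w) g)^*) =
  cexpect P (fun w => inner (X h w) f * (inner (X 0 w) g)^*).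
Proof.
move=> hf hg; rewrite (cross_moment (t + h) t hf hg) (cross_moment h 0 hf hg).
have mcov s' t' : cmeasurable_fun (I `*` I)
    (fun p : RR * RR => g p.2 * cov_kernel P X s' t' p.1 p.2).
  apply: cmeasurableM; last exact: measurable_cov_kernel.
  by apply: measurable_snd_comp; move: hg; rewrite inHE => -[].
have mfJ : cmeasurable_fun (I : set RR) (fun u => (f u)^*).
  by move: (inH_J hf); rewrite inHE => -[].
have [_ _ _ /(_ h t) hst] := hX.
have := @ae_product_slices _ _ _ _ R leb leb _ hst => hsl.
apply: ae_eq_cintegral.
- exact: mI.
- by apply: cmeasurableM => //; exact: (cmeasurable_parametric leb mI mI (mcov _ _)).
- by apply: cmeasurableM => //; exact: (cmeasurable_parametric leb mI mI (mcov _ _)).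
apply: filterS hsl => u hu Iu; apply: (congr1 (fun z => (f u)^* * z)).
apply: ae_eq_cintegral.
- exact: mI.
- exact: (cmeasurable_slice mI mI Iu (mcov _ _)).
- exact: (cmeasurable_slice mI mI Iu (mcov _ _)).
by apply: filterS hu => v hv Iv; rewrite (hv _)//=.
Qed.

Definition score f (hf : inH f) t : LP := toL2 measurableT (score_L2 t hf).

Lemma ip_score f g (hf : inH f) (hg : inH g) s t s' t' : s - t = s' - t' ->
  ipP (score hf s) (score hg t) = ipP (score hf s') (score hg t').
Proof.
have E r q : ipP (score hf r) (score hg q) =
    cexpect P (fun w => inner (X (q + (r - q)) w) f * (inner (X q w) g)^*).
  by rewrite addrC subrK.
move=> st; rewrite (E s t) (E s' t') (cross_moment_stationary _ _ hf hg).
by rewrite [RHS](cross_moment_stationary _ _ hf hg) st.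
Qed.

(** The diagonal of the unit square is a null set, so the covariance kernel does
    not give the mean of [sqnormH] directly.  Parseval's identity expresses it by
    the second moments of the scores in the basis [b]. *)
Lemma expected_sqnorm_const (b : nat -> R -> R[i]) t : orthonormal_basis b ->
  (\int[P]_w sqnormH (X t w) = \int[P]_w sqnormH (X 0 w))%E.
Proof.
move=> hb; have ib := hb.1.1.
have E t' : (\int[P]_w sqnormH (X t' w) =
    \sum_(0 <= k <oo) (sqn ipP (score (ib k) t'))%:E)%E.
  under eq_integral do rewrite (sqnormH_series hb (Xin _ _)).
  rewrite integral_nneseries//.
  - by apply: eq_eseriesr => k _; rewrite L2_nsq.
  - by move=> k; apply: measurable_EFin_sqr_cmod; case: (score_L2 t' (ib k)).
  - by move=> k w _; rewrite lee_fin sqr_ge0.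
rewrite !E; apply: eq_eseriesr => k _; rewrite /sqn.
by rewrite (ip_score (ib k) (ib k) (s' := 0) (t' := 0)) ?subrr.
Qed.

Section Filters.
Variable f : int -> R -> R[i].
Hypothesis hf : forall l, inH (f l).

Definition filtered_score N t : LP := \sum_(k < N.*2.+1) score (hf (k%:Z - N%:Z)) (t - (k%:Z - N%:Z)).

Lemma filtered_scoreE N t w : L2val (filtered_score N t) w = filtered X (fun=> f) N t w.
Proof. by rewrite L2val_sum. Qed.

Lemma ip_filtered_score M N t :
  ipP (filtered_score M t) (filtered_score N t) =
  ipP (filtered_score M 0) (filtered_score N 0).
Proof.
rewrite !(ip_suml HipP); apply: eq_bigr => k _.
rewrite !(ip_sumr HipP); apply: eq_bigr => j _.
by apply: ip_score; ring.
Qed.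

Lemma nsq_filtered_sub M N t :
  sqn ipP (filtered_score M t - filtered_score N t) =
  sqn ipP (filtered_score M 0 - filtered_score N 0).
Proof. by rewrite !(nsqB HipP) /sqn !ip_filtered_score. Qed.

(** The mean square distance between two truncations is the same at all times,
    so the Cauchy criterion at time 0 is uniform in time. *)
Lemma mean_square_filtered_uniform (Y : int -> Omega -> R[i]) :
  (forall t, mean_square_filtered P X f t (Y t)) -> forall e : R, 0 < e ->
  \forall N \near \oo, forall t,
    (\int[P]_w ((cmod (Y t w - filtered X (fun=> f) N t w)) ^+ 2)%:E <= e%:E)%E.
Proof.
move=> hY e e0.
have mfil N t : cmeasurable_fun setT (filtered X (fun=> f) N t).
  have [h _] := L2P (filtered_score N t); apply: cmeasurable_ext h => w _.
  exact: filtered_scoreE.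
pose D N t w := Y t w - filtered X (fun=> f) N t w.
have mD N t : cmeasurable_fun setT (D N t).
  by apply: cmeasurableB => //; case: (hY t).
have e16 : 0 < e / 16 by rewrite divr_gt0.
have [N0 _ hN0] := cvge0_near (hY 0).2 e16.
have tail M N t : (N0 <= M)%N -> (N0 <= N)%N ->
    (sqint P setT (fun w => filtered X (fun=> f) M t w - filtered X (fun=> f) N t w)%R
     <= (e / 4)%:E)%E.
  move=> hM hN.
  have E t' : sqint P setT (fun w => filtered X (fun=> f) M t' w -
      filtered X (fun=> f) N t' w) = (sqn ipP (filtered_score M t' - filtered_score N t'))%:E.
    rewrite L2_nsq; apply: eq_sqint => w _.
    by rewrite -!filtered_scoreE.
  rewrite E nsq_filtered_sub -E.
  have -> : (fun w => filtered X (fun=> f) M 0 w - filtered X (fun=> f) N 0 w) =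
      (fun w => D N 0 w + -1 * D M 0 w) by apply/funext => w; rewrite /D; ring.
  have mDM : cmeasurable_fun setT (fun w => -1 * D M 0 w).
    by apply: cmeasurableM => //; exact: cmeasurable_cst.
  apply: (le_trans (sqintD_le P measurableT (mD N 0) mDM)).
  rewrite sqintZ// cmodN cmod1 expr1n mul1e.
  have hi := hN0 _ hM; have hj := hN0 _ hN.
  have -> : (e / 4)%:E = (2%:E * (e / 16)%:E + 2%:E * (e / 16)%:E)%E.
    by rewrite -!EFinM -EFinD; congr EFin; field.
  by apply: leeD; apply: lee_wpmul2l.
exists N0 => // N hN t.
have e4 : 0 < e / 4 by rewrite divr_gt0.
have [M1 _ hM1] := cvge0_near (hY t).2 e4.
pose M := maxn N0 M1.
have -> : (\int[P]_w ((cmod (Y t w - filtered X (fun=> f) N t w)) ^+ 2)%:E)%E =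
  sqint P setT (fun w => D M t w + (filtered X (fun=> f) M t w - filtered X (fun=> f) N t w)).
  by apply: eq_sqint => w _; rewrite /D; ring.
apply: (le_trans (sqintD_le P measurableT (mD M t) (cmeasurableB (mfil _ _) (mfil _ _)))).
have -> : e%:E = (2%:E * (e / 4)%:E + 2%:E * (e / 4)%:E)%E.
  by rewrite -!EFinM -EFinD; congr EFin; field.
apply: leeD; apply: lee_wpmul2l => //.
  by apply: hM1; exact: leq_maxr.
by apply: tail => //; exact: leq_maxl.
Qed.

End Filters.
End StationaryScores.

(** * Filter coefficients *)

Section FilterCoefficients.
Variable R : realType.
Local Notation leb := (@lebesgue_measure R).
Local Notation I := (@unitI R).
Local Notation mI := (@measurable_unitI R).
Local Notation mfreq := (@measurable_freqI R).
Local Notation RR := (measurableTypeR R).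
Local Notation freq := (@freqI R : set RR).
Implicit Types f g : R -> R -> R[i].

Definition joint_L2 f : Prop :=
  cmeasurable_fun (freq `*` I) (fun p : RR * RR => f p.1 p.2) /\
  (\int[leb]_(s in freq) sqnormH (f s) < +oo)%E.

Lemma lebesgue_freqI : (leb freq = (2 * pi)%:E :> \bar R)%E.
Proof.
rewrite /freqI lebesgue_measure_itv/= lte_fin.
have p0 := pi_gt0 R; rewrite ifT; last by lra.
by rewrite -EFinB; congr EFin; ring.
Qed.

Lemma cmod_cis (s : R) : cmod (cis s) ^+ 2 = 1.
Proof. by rewrite sqr_cmod /= cos2Dsin2. Qed.

Section OneFunction.
Variable f : R -> R -> R[i].
Hypothesis hf : joint_L2 f.

Let exchange := @sqint_exchange _ _ _ _ R leb leb freq I mfreq mI f hf.1.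
Let mslices := @measurable_sqint_slices _ _ _ _ R leb freq I mfreq mI f hf.1.

Lemma ae_slice_L2 : {ae leb, forall u, I u -> in_L2 leb freq (fun s => f s u)}.
Proof. exact: (@ae_slice_in_L2 _ _ _ _ R leb leb freq I mfreq mI f hf.1 hf.2). Qed.

Lemma filter_coef_measurable l : cmeasurable_fun (I : set RR) (filter_coef f l).
Proof.
have h := cmeasurable_drop_first ([set: RR]) mfreq mI hf.1.
have h2 := @measurable_filter_coef R _ RR setT (fun=> f) l measurableT h.
exact: (@cmeasurable_slice R _ _ RR RR setT I
  (fun p : RR * RR => filter_coef f l p.2) 0 measurableT mI Logic.I h2).
Qed.

(** The Cauchy-Schwarz inequality at almost every point of the unit interval,
    against an exponential, followed by Tonelli's theorem. *)
Lemma sqnormH_filter_coef_le l :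
  (sqnormH (filter_coef f l) <= \int[leb]_(s in freq) sqnormH (f s))%E.
Proof.
rewrite -[leRHS]exchange; apply: ae_ge0_le_integral.
- exact: mI.
- by move=> u _; rewrite lee_fin sqr_ge0.
- exact: measurable_EFin_sqr_cmod (filter_coef_measurable l).
- by move=> u _; exact: sqint_ge0.
- exact: mslices.
have := ae_slice_L2; apply: filterS => u h Iu; have hfu := h Iu.
pose e (s : RR) := cis (l%:~R * s).
have nJ s : (e s)^* = cis (- (l%:~R * s)).
  by apply: complex_eqP; rewrite ?ReJ ?ImJ /= ?cosN ?sinN.
have fe : (sqint leb freq e = (2 * pi)%:E)%E.
  rewrite /sqint; under eq_integral do rewrite cmod_cis.
  by rewrite integral_cst; [rewrite mul1e; exact: lebesgue_freqI|exact: mfreq].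
have he : in_L2 leb freq e.
  by split; [exact: measurable_cis|rewrite fe ltry].
have := cauchy_schwarz (L2_semi_inner leb mfreq) (toL2 mfreq hfu) (toL2 mfreq he).
have fe' : sqint leb freq (L2val (toL2 mfreq he)) = (2 * pi)%:E by exact: fe.
set c := L2ip _ _; rewrite -lee_fin [X in (_ <= X)%E]EFinM !L2_nsq fe' => hc.
have -> : filter_coef f l u = ((2 * pi)^-1)%:C * c.
  apply: (congr1 (fun z => _ * z)); apply: eq_cintegral => s _.
  by rewrite -nJ.
have p0 : 0 < 2 * pi :> R by rewrite mulr_gt0// pi_gt0.
have p1 : (2 * pi)^-1 <= 1 :> R.
  by rewrite invf_le1//; have := pi_ge2 R; lra.
rewrite cmodM cmodR exprMn real_normK ?num_real//.
rewrite EFinM.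
apply: (@le_trans _ _ (((2 * pi)^-1 ^+ 2)%:E * (sqint leb freq (fun s => f s u) * (2 * pi)%:E))%E).
  by apply: lee_wpmul2l => //; rewrite lee_fin sqr_ge0.
rewrite muleCA -EFinM expr2 divfK ?gt_eqF//.
by rewrite -[leRHS]mule1; apply: lee_wpmul2l; rewrite ?sqint_ge0// lee_fin.
Qed.

Lemma inH_filter_coef l : inH (filter_coef f l).
Proof.
rewrite inHE; split; first exact: filter_coef_measurable.
exact: le_lt_trans (sqnormH_filter_coef_le l) hf.2.
Qed.

End OneFunction.

Lemma joint_L2B f g : joint_L2 f -> joint_L2 g ->
  joint_L2 (fun s u => f s u - g s u).
Proof.
move=> [mf ff] [mg fg]; have mB := cmeasurableB mf mg; split; first exact: mB.
have mS h : cmeasurable_fun (freq `*` I) (fun p : RR * RR => h p.1 p.2) ->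
    measurable_fun freq (fun s => sqnormH (h s)).
  exact: (measurable_sqnormH mfreq).
apply: (@le_lt_trans _ _
   (\int[leb]_(s in freq) (2%:E * sqnormH (f s) + 2%:E * sqnormH (g s)))%E).
  apply: ge0_le_integral.
  - exact: mfreq.
  - by move=> s _; exact: sqnormH_ge0.
  - exact: mS.
  - by apply: emeasurable_funD; apply: measurable_funeM; exact: mS.
  move=> s fs.
  have mfs := cmeasurable_slice mfreq mI fs mf.
  have mgs := cmeasurable_slice mfreq mI fs mg.
  have mNgs := cmeasurableM (cmeasurable_cst (I : set RR) (-1)) mgs.
  have := sqintD_le leb mI mfs mNgs; rewrite sqintZ//; last exact: mI.
  rewrite cmodN cmod1 expr1n mul1e; apply: le_trans; rewrite le_eqVlt; apply/orP; left.
  by apply/eqP; apply: eq_sqint => u _; rewrite mulN1r.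
rewrite ge0_integralD; last 5 first.
- exact: mfreq.
- by move=> s _; rewrite mule_ge0 ?sqnormH_ge0.
- by apply: measurable_funeM; exact: mS.
- by move=> s _; rewrite mule_ge0 ?sqnormH_ge0.
- by apply: measurable_funeM; exact: mS.
rewrite !ge0_integralZl_EFin//; try exact: mfreq; try exact: mS;
  try (by move=> s _; exact: sqnormH_ge0).
by apply: lte_add_pinfty; [apply: (lte_mul_pinfty _ _ ff)|apply: (lte_mul_pinfty _ _ fg)];
  rewrite ?lee_fin.
Qed.

(** Linearity of the coefficients holds at the points of the unit interval where
    both slices are square integrable, that is almost everywhere. *)
Lemma sqnormH_filter_coefB_le f g l : joint_L2 f -> joint_L2 g ->
  (sqnormH (fun u => filter_coef f l u - filter_coef g l u)%R <=
   \int[leb]_(s in freq) sqnormH (fun u => f s u - g s u)%R)%E.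
Proof.
move=> hf hg; have hB := joint_L2B hf hg.
apply: le_trans (sqnormH_filter_coef_le hB l); rewrite le_eqVlt; apply/orP; left.
apply/eqP; apply: ae_eq_sqint.
- exact: mI.
- by apply: cmeasurableB; exact: filter_coef_measurable.
- exact: filter_coef_measurable.
have := ae_slice_L2 hf; have := ae_slice_L2 hg.
apply: filterS2 => u hgu hfu Iu.
rewrite /filter_coef -mulrBr; apply: (congr1 (fun z => _ * z)).
have he : in_L2 leb freq (fun s => cis (- (l%:~R * s))).
  split.
    have := measurable_cis freq (- l%:~R); apply: cmeasurable_ext => s _.
    by rewrite mulNr.
  rewrite /sqint; under eq_integral do rewrite cmod_cis.
  rewrite integral_cst; last exact: mfreq.
  by rewrite mul1e; apply: (eq_ind_r (fun z => z < +oo)%E _ lebesgue_freqI); exact: ltry.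
have i1 := cintegrableM mfreq (hfu Iu) he.
have i2 := cintegrableM mfreq (hgu Iu) he.
have := cintegral_lin mfreq (-1) i2 i1; rewrite mulN1r addrC => <-.
by apply: eq_cintegral => s _; ring.
Qed.

End FilterCoefficients.

Lemma markov_ge0 d (T : measurableType d) (R : realType) (P : probability T R)
    (Z : T -> \bar R) : measurable_fun setT Z -> (forall w, 0 <= Z w)%E ->
  (P [set w | 1 <= Z w] <= \int[P]_w Z w)%E.
Proof.
move=> mZ Z0.
have mE : measurable [set w | (1 <= Z w)%E].
  by rewrite -[X in measurable X]setTI; exact: emeasurable_fun_c_infty.
have -> : P [set w | (1 <= Z w)%E] = (\int[P]_w (\1_[set w | (1 <= Z w)%E] w)%:E)%E.
  by rewrite integral_indic// setIT.
have m1 : measurable_fun setT (fun w => (\1_[set w | (1 <= Z w)%E] w)%:E : \bar R).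
  by apply/measurable_EFinP; exact: measurable_indic.
apply: ge0_le_integral => // w _; rewrite indicE.
by have [|_] := boolP (w \in _); [rewrite inE|exact: Z0].
Qed.

(** * Consistency of the estimated eigenfunctions *)

Section EigenfunctionConsistency.
Variables (R : realType) (d : measure_display) (Omega : measurableType d).
Variable P : probability Omega R.
Local Notation leb := (@lebesgue_measure R).
Local Notation I := (@unitI R).
Local Notation mI := (@measurable_unitI R).
Local Notation mfreq := (@measurable_freqI R).
Local Notation RR := (measurableTypeR R).
Local Notation freq := (@freqI R : set RR).
Variables (b : nat -> R -> R[i]) (hb : orthonormal_basis b).
Variables (F : R -> oper R) (T : nat -> Omega -> R -> oper R).
Hypothesis hF : forall theta, freqI theta -> hilbert_schmidt b (F theta).
Hypothesis hT : forall n w theta, freqI theta -> hilbert_schmidt b (T n w theta).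
Hypothesis mF : forall k j,
  cmeasurable_fun freq (fun theta : RR => inner (F theta (b k)) (b j)).
Hypothesis mT : forall n k j, cmeasurable_fun (setT `*` freq)
  (fun p : Omega * RR => inner (T n p.1 p.2 (b k)) (b j)).
Variables (lam : R -> nat -> R) (m : nat) (phi : R -> R -> R[i]).
Variable phihat : nat -> Omega -> R -> R -> R[i].
Hypothesis hlam : forall theta k, freqI theta -> nth_eigenvalue (F theta) k (lam theta k).
Hypothesis mphi : cmeasurable_fun (freq `*` I) (fun p : RR * RR => phi p.1 p.2).
Hypothesis hphi : forall theta, freqI theta ->
  unit_eigenfunction (F theta) (lam theta m) (phi theta).
Hypothesis mphihat : forall n, cmeasurable_fun (setT `*` freq `*` I)
  (fun q : Omega * RR * RR => phihat n q.1.1 q.1.2 q.2).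
Hypothesis hphihat : forall n w theta, freqI theta ->
  nth_unit_eigenfunction (T n w theta) m (phihat n w theta).

Lemma phihat_unit n w theta : freqI theta ->
  inH (phihat n w theta) /\ sqnormH (phihat n w theta) = 1%E.
Proof. by move=> ft; have [l _ [[]]] := hphihat n w ft. Qed.

Lemma phi_unit theta : freqI theta -> inH (phi theta) /\ sqnormH (phi theta) = 1%E.
Proof. by move=> ft; have [[]] := hphi ft. Qed.

Definition eigen_error n w theta : \bar R :=
  sqnormH (fun u => phihat n w theta u - phi theta u).

Lemma eigen_error_ge0 n w theta : (0 <= eigen_error n w theta)%E.
Proof. exact: sqnormH_ge0. Qed.

Lemma eigen_error_le4 n w theta : freqI theta -> (eigen_error n w theta <= 4%:E)%E.
Proof.
move=> ft; have [i1 n1] := phihat_unit n w ft; have [i2 n2] := phi_unit ft.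
have := nsqB_le (ipH_semi_inner R) (toH i1) (toH i2).
rewrite -lee_fin EFinD 2!EFinM !nsqH => h; apply: (le_trans h).
have -> : sqnormH (ofH (toH i1)) = 1%E by exact: n1.
have -> : sqnormH (ofH (toH i2)) = 1%E by exact: n2.
by rewrite !mule1 -EFinD lee_fin; lra.
Qed.

Lemma measurable_eigen_error n :
  measurable_fun (setT `*` freq) (fun p : Omega * RR => eigen_error n p.1 p.2).
Proof.
apply: (measurable_sqnormH (measurableX measurableT mfreq)
  (f := fun (p : Omega * RR) u => phihat n p.1 p.2 u - phi p.2 u)).
apply: cmeasurableB; first exact: mphihat.
exact: (cmeasurable_drop_first ([set: Omega]) mfreq mI mphi).
Qed.

Definition operator_error n w theta : \bar R :=
  (hsnorm b (op_sub (F theta) (T n w theta)) ^+ 2)%E.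

Lemma operator_error_ge0 n w theta : (0 <= operator_error n w theta)%E.
Proof.
by rewrite /operator_error sqr_hsnorm; apply: nneseries_ge0 => k _ _; exact: sqnormH_ge0.
Qed.

Lemma measurable_operator_error n :
  measurable_fun (setT `*` freq) (fun p : Omega * RR => operator_error n p.1 p.2).
Proof.
pose c k j (p : Omega * RR) := (cmod (inner (F p.2 (b k)) (b j) -
  inner (T n p.1 p.2 (b k)) (b j)) ^+ 2)%:E.
have mFp k j : cmeasurable_fun (setT `*` freq)
    (fun p : Omega * RR => inner (F p.2 (b k)) (b j)).
  apply: (cmeasurable_comp (g := fun z : Omega * RR => z.2) mfreq _ _ (mF k j)).
    by move=> [? ?] [].
  by apply: measurable_funTS; exact: measurable_snd.
have mc k j : measurable_fun (setT `*` freq) (c k j).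
  by apply: measurable_EFin_sqr_cmod; exact: cmeasurableB.
have c0 k j p : (0 <= c k j p)%E by rewrite lee_fin sqr_ge0.
apply: (@eq_measurable_fun _ _ _ _ (setT `*` freq)
   (fun p => \sum_(0 <= k <oo) \sum_(0 <= j <oo) c k j p)%E).
  move=> [w th]; rewrite inE => -[_ /= fth].
  have [bF _] := hF fth; have [bT _] := hT n w fth.
  by rewrite /operator_error (sqr_hsnorm_coord hb bF bT).
apply: ge0_emeasurable_sum.
  by move=> k p _ _; apply: nneseries_ge0.
by move=> k _; apply: ge0_emeasurable_sum.
Qed.

Hypothesis B1 : (fun n => \int[leb]_(theta in freq) \int[P]_w operator_error n w theta)%E
  @ \oo --> 0%E.
Hypothesis B2 : finite_set [set theta | freqI theta /\ alpha (lam theta) m = 0].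
Variables (v : R -> R[i]) (hv : inH v).
Hypothesis B3 : {ae leb, forall theta, freqI theta -> inner (phi theta) v <> 0}.
Hypothesis horient : {ae leb, forall theta, freqI theta -> 0 <= inner (phi theta) v}.
Hypothesis horienthat : forall n w,
  {ae leb, forall theta, freqI theta -> 0 <= inner (phihat n w theta) v}.

Lemma ae_simple_eigenvalue : {ae leb, forall theta, freqI theta -> alpha (lam theta) m <> 0}.
Proof.
have cB := finite_set_countable B2.
exists [set theta | freqI theta /\ alpha (lam theta) m = 0]; split.
- exact: (@countable_measurable _ RR _ (fun t => measurable_set1 t) cB).
- exact: (countable_lebesgue_measure0 cB).
- by move=> th /= h; have /not_implyP[? /contrapT ?] := h.
Qed.

(** The hypothesis holds at almost all frequencies for each outcome; Fubini's
    theorem gives it almost surely at almost each frequency. *)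
Lemma ae_oriented : {ae leb, forall theta, freqI theta ->
  forall n, {ae P, forall w, 0 <= inner (phihat n w theta) v}}.
Proof.
pose h n (p : Omega * RR) := inner (phihat n p.1 p.2) v.
have mh n : cmeasurable_fun (setT `*` freq) (h n).
  have mv : cmeasurable_fun (I : set RR) v by move: hv; rewrite inHE => -[].
  apply: (measurable_inner (measurableX measurableT mfreq) (mphihat n)).
  exact: measurable_snd_comp.
pose N n : set (Omega * RR) := (setT `*` freq) `&`
  ((fun p => complex.Im (h n p) : RR) @^-1` (~` [set 0]) `|`
   (fun p => complex.Re (h n p) : RR) @^-1` `]-oo, 0[%classic).
have mN n : measurable (N n).
  rewrite /N setIUr; apply: measurableU.
    apply: (mh n).2; first exact: (measurableX measurableT mfreq).
    by apply: measurableC; exact: measurable_set1.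
  apply: (mh n).1; first exact: (measurableX measurableT mfreq).
  exact: measurable_itv.
have NP n w th : freqI th -> ~ N n (w, th) <-> 0 <= inner (phihat n w th) v.
  have ge0E (z : R[i]) : (0 <= z) = (complex.Im z == 0) && (0 <= complex.Re z).
    by rewrite lecE.
  move=> ft; rewrite ge0E; split.
    move=> nN; apply/andP; split.
      apply/eqP; apply: contrapT => h0.
      by apply: nN; split; [split|left; exact: h0].
    rewrite leNgt; apply/negP => h0; apply: nN; split; first by split.
    by right; rewrite /preimage/= in_itv.
  move=> /andP[/eqP i0 r0] [_ [|]]; first by apply.
  by rewrite /preimage/= in_itv/= ltNge r0.
have key n : {ae leb, forall th, freqI th -> {ae P, forall w, 0 <= inner (phihat n w th) v}}.
  have := @ae_exchange _ _ _ _ R P leb setT freq measurableT mfreq (N n) (mN n).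
  move=> H; have {}H := H _.
  have {}H : {ae leb, forall y, freqI y -> {ae P, forall x, setT x -> ~ N n (x, y)}}.
    apply: H => w _; have := horienthat n w; apply: filterS => th hth ft.
    by apply/NP => //; exact: hth.
  apply: filterS H => th H ft; have := H ft; apply: filterS => w hw.
  by apply/NP => //; exact: hw.
have := ae_foralln key; apply: filterS => th H ft n; exact: H.
Qed.

(** After exchanging the two integrals, [integral_dominated_cvg0] applies with the
    constants of [eigenfunction_stability], which exist at the frequencies where
    the eigenvalue is simple, [phi] is not orthogonal to [v], and the
    orientations are right. *)
Theorem eigenfunctions_consistent :
  (fun n => \int[P]_w \int[leb]_(theta in freq) eigen_error n w theta)%E @ \oo --> 0%E.
Proof.
have mA := measurable_eigen_error.
have mswap (f : Omega -> R -> \bar R) :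
    measurable_fun (setT `*` freq) (fun p : Omega * RR => f p.1 p.2) ->
    (forall w th, 0 <= f w th)%E ->
    measurable_fun freq (fun th : RR => \int[P]_w f w th)%E.
  move=> mf f0; apply: (measurable_parametric_integral P mfreq measurableT
    (f := fun z : RR * Omega => f z.2 z.1)) => //.
  exact: (measurable_fun_swap measurableT mfreq mf).
have mslice (f : Omega -> R -> \bar R) th : freqI th ->
    measurable_fun (setT `*` freq) (fun p : Omega * RR => f p.1 p.2) ->
    measurable_fun setT (fun w => f w th).
  move=> fth mf.
  have mg : measurable_fun setT (fun w : Omega => (w, th : RR)) by exact: pair2_measurable.
  apply: (measurable_comp (F := setT `*` freq) (f := fun p : Omega * RR => f p.1 p.2)
    _ _ mf mg).
    exact: (measurableX measurableT mfreq).
  by move=> _ [w _ <-].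
have -> : (fun n => \int[P]_w \int[leb]_(theta in freq) eigen_error n w theta)%E =
    (fun n => \int[leb]_(theta in freq) \int[P]_w eigen_error n w theta)%E.
  apply/funext => n.
  apply: (@tonelli_rect _ _ _ _ R P leb setT freq measurableT mfreq
     (fun p => eigen_error n p.1 p.2) (mA n)) => z _; exact: eigen_error_ge0.
apply: (@integral_dominated_cvg0 _ RR R leb freq 4
  (fun n th => \int[P]_w eigen_error n w th)%E
  (fun n th => \int[P]_w operator_error n w th)%E) => //.
- exact: mfreq.
- by have h : (leb freq < +oo)%E by rewrite lebesgue_freqI ltry.
- by move=> n; apply: mswap => //; exact: eigen_error_ge0.
- move=> n; apply: mswap; first exact: measurable_operator_error.
  exact: operator_error_ge0.
- by move=> n th _; apply: integral_ge0 => w _; exact: eigen_error_ge0.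
- by move=> n th _; apply: integral_ge0 => w _; exact: operator_error_ge0.
- move=> n th fth.
  apply: (@le_trans _ _ (\int[P]_w (cst 4%:E w))%E).
    apply: ge0_le_integral => //.
    + by move=> w _; exact: eigen_error_ge0.
    + exact: (mslice (eigen_error n) th fth (mA n)).
    + by move=> w _; exact: eigen_error_le4.
  rewrite integral_cst//.
  have h : (4%:E * P [set: Omega] <= 4%:E :> \bar R)%E by rewrite probability_setT mule1.
  exact: h.
have H34 : {ae leb, forall th, freqI th -> 0 <= inner (phi th) v /\ inner (phi th) v <> 0}.
  by apply: filterS2 horient B3 => th h3 h4 fth; split; [exact: h3|exact: h4].
apply: filterS3 ae_oriented ae_simple_eigenvalue H34 => th h1 h2 h34 fth.
have [h3 h4] := h34 fth.
have [C [C0 hC]] := eigenfunction_stability hb (hF fth) (fun k => hlam k fth) (hphi fth)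
  (h2 fth) hv h3 h4.
exists C => n.
have mop := mslice (operator_error n) th fth (measurable_operator_error n).
have op0 w : (0 <= operator_error n w th)%E by exact: operator_error_ge0.
rewrite -ge0_integralZl_EFin//; last exact: ltW.
apply: ae_ge0_le_integral => //.
- by move=> w _; exact: eigen_error_ge0.
- exact: (mslice (eigen_error n) th fth (mA n)).
- by move=> w _; rewrite mule_ge0// lee_fin ltW.
- exact: measurable_funeM.
- have := h1 fth n; apply: filterS => w hw _.
  exact: (hC _ _ (hT n w fth) (hphihat n w fth) hw).
Qed.

End EigenfunctionConsistency.

(** * Random perturbation of a truncated filter *)

Section Deviation.
Variables (R : realType) (d : measure_display) (Omega : measurableType d).
Variable P : probability Omega R.
Local Notation leb := (@lebesgue_measure R).
Local Notation I := (@unitI R).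
Local Notation mI := (@measurable_unitI R).
Local Notation RR := (measurableTypeR R).

(** The Cauchy-Schwarz inequality, with the product of the two norms split by the
    weight [eta]. *)
Lemma inner_diff_le (x f g : R -> R[i]) (D : \bar R) (eta : R) :
  inH x -> inH f -> inH g -> 0 < eta ->
  (sqnormH (fun u => f u - g u)%R <= D)%E ->
  ((cmod (inner x f - inner x g))%:E <= eta%:E * sqnormH x + eta^-1%:E * D)%E.
Proof.
move=> hx hf hg e0 fgD; have hB := inH_sub hf hg.
have -> : inner x f - inner x g = ipH (toH hx) (toH hB).
  exact: esym (ipBr (ipH_semi_inner R) (toH hf) (toH hg) (toH hx)).
apply: (@le_trans _ _ (eta%:E * sqnormH x + eta^-1%:E * sqnormH (fun u => f u - g u)%R)%E).
  rewrite -(nsqH (toH hx)) -(nsqH (toH hB)) -!EFinM -EFinD lee_fin.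
  have := cauchy_schwarz (ipH_semi_inner R) (toH hx) (toH hB).
  have := nsq_ge0 (ipH_semi_inner R) (toH hx); have := nsq_ge0 (ipH_semi_inner R) (toH hB).
  set z := sqn _ (toH hx); set y := sqn _ (toH hB); set c := ipH _ _ => y0 z0 hc.
  have i0 : 0 < eta^-1 by rewrite invr_gt0.
  have nn : 0 <= eta * z + eta^-1 * y by rewrite addr_ge0// mulr_ge0// ltW.
  rewrite -ler_sqr ?nnegrE ?cmod_ge0//; apply: (le_trans hc).
  have -> : z * y = (eta * z) * (eta^-1 * y) by rewrite mulrACA divff ?mul1r// gt_eqF.
  have : 0 <= eta * z by rewrite mulr_ge0// ltW.
  have : 0 <= eta^-1 * y by rewrite mulr_ge0// ltW.
  by move: (eta * z) (eta^-1 * y) => a b' a0 b0; nra.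
by apply: leeD => //; apply: lee_wpmul2l => //; rewrite lee_fin ltW// invr_gt0.
Qed.

Variable X : int -> Omega -> R -> R[i].
Hypothesis hX : H_process X.
Variable M : R.
Hypothesis XM : forall t, (\int[P]_w sqnormH (X t w) = M%:E)%E.

Let Xin t w : inH (X t w). Proof. by case: (hX t). Qed.
Let mX t : measurable_fun setT (fun w => sqnormH (X t w)).
Proof. exact: (measurable_sqnormH measurableT (measurable_process hX t)). Qed.

Let M0 : 0 <= M.
Proof. by rewrite -lee_fin -(XM 0); apply: integral_ge0 => w _; exact: sqnormH_ge0. Qed.

(** Each of the [2N+1] terms of the difference of the filters is a product of the
    norms of [X] and of the difference of coefficients.  Split with the weight
    [eta = (N+1)^-2], the sum has mean at most [2M/(N+1) + 2(N+1)^3 E D], and the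
    last term is at most [2/(N+1)].  Markov's inequality is applied once, to a
    combination [V] of the two errors that is at least 1 as soon as one of them
    reaches [eps / 2]. *)
Lemma deviation_bound (f : int -> R -> R[i]) (g : Omega -> int -> R -> R[i])
    (D : Omega -> \bar R) (Y : Omega -> R[i]) N t (eps e1 : R) :
  0 < eps -> (forall l, inH (f l)) -> (forall w l, inH (g w l)) ->
  (forall w l, sqnormH (fun u => g w l u - f l u)%R <= D w)%E ->
  measurable_fun setT D -> (forall w, 0 <= D w)%E ->
  (((N.+1)%:R ^+ 4)%:E * \int[P]_w D w <= 1)%E ->
  cmeasurable_fun setT (filtered X g N t) ->
  cmeasurable_fun setT (filtered X (fun=> f) N t) -> cmeasurable_fun setT Y ->
  (\int[P]_w ((cmod (Y w - filtered X (fun=> f) N t w)) ^+ 2)%:E <= e1%:E)%E ->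
  (P [set w | (eps <= cmod (filtered X g N t w - Y w))%R] <=
   (4 * (M + 1) / eps / N.+1%:R + 4 / eps ^+ 2 * e1)%:E)%E.
Proof.
move=> e0 fH gH gfD mD D0 hD mg mf mY hY.
pose n1 : R := N.+1%:R; have n10 : 0 < n1 by rewrite ltr0n.
pose eta : R := n1 ^- 2; have eta0 : 0 < eta by rewrite invr_gt0 exprn_gt0.
pose K : R := N.*2.+1%:R; have K0 : 0 <= K by exact: ler0n.
pose S w := (\sum_(k < N.*2.+1) sqnormH (X (t - (k%:Z - N%:Z)) w))%E.
pose U w := (eta%:E * S w + (K * eta^-1)%:E * D w)%E.
pose B w := ((cmod (Y w - filtered X (fun=> f) N t w)) ^+ 2)%:E.
pose V w := ((2 / eps)%:E * U w + (4 / eps ^+ 2)%:E * B w)%E.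
have S0 w : (0 <= S w)%E by apply: sume_ge0 => k _; exact: sqnormH_ge0.
have Ke0 : 0 <= K * eta^-1 by rewrite mulr_ge0// ltW// invr_gt0.
have U0 w : (0 <= U w)%E by rewrite adde_ge0// mule_ge0// lee_fin// ltW.
have B0 w : (0 <= B w)%E by rewrite lee_fin sqr_ge0.
have c20 : 0 <= 2 / eps by rewrite divr_ge0// ltW.
have c40 : 0 <= 4 / eps ^+ 2 by rewrite divr_ge0// sqr_ge0.
have V0 w : (0 <= V w)%E by rewrite adde_ge0// mule_ge0// lee_fin.
have mS : measurable_fun setT S by apply: emeasurable_sum => k; exact: mX.
have mU : measurable_fun setT U by apply: emeasurable_funD; exact: measurable_funeM.
have mB : measurable_fun setT B by apply: measurable_EFin_sqr_cmod; exact: cmeasurableB.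
have mV : measurable_fun setT V by apply: emeasurable_funD; exact: measurable_funeM.
have AU w : ((cmod (filtered X g N t w - filtered X (fun=> f) N t w))%:E <= U w)%E.
  rewrite /filtered /symsum -sumrB.
  apply: (@le_trans _ _ (\sum_(k < N.*2.+1) (eta%:E * sqnormH (X (t - (k%:Z - N%:Z)) w) +
      eta^-1%:E * D w))%E).
    apply: (@le_trans _ _ (\sum_(k < N.*2.+1)
       (cmod (inner (X (t - (k%:Z - N%:Z)) w) (g w (k%:Z - N%:Z)) -
              inner (X (t - (k%:Z - N%:Z)) w) (f (k%:Z - N%:Z))))%:E)%E).
      by rewrite sumEFin lee_fin; exact: le_cmod_sum.
    by apply: lee_sum => k _; exact: inner_diff_le.
  rewrite big_split/= /U leeD//.
    by rewrite /S ge0_sume_distrr// => k _; exact: sqnormH_ge0.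
  rewrite big_const_ord /K; elim: N.*2.+1 => [|j IH] /=.
    by rewrite mul0r mul0e.
  rewrite -natr1 mulrDl mul1r EFinD ge0_muleDl ?lee_fin//.
  - by rewrite addeC leeD.
  - by rewrite mulr_ge0// ltW// invr_gt0.
  - by rewrite ltW// invr_gt0.
have mE : measurable [set w | (eps <= cmod (filtered X g N t w - Y w))%R].
  have -> : [set w | (eps <= cmod (filtered X g N t w - Y w))%R] =
    [set w | ((eps ^+ 2)%:E <= (cmod (filtered X g N t w - Y w) ^+ 2)%:E)%E].
    apply/funext => w; apply/propext; rewrite /= lee_fin.
    by rewrite ler_sqr ?nnegrE ?cmod_ge0// ltW.
  rewrite -[X in measurable X]setTI; apply: emeasurable_fun_c_infty => //.
  by apply: measurable_EFin_sqr_cmod; exact: cmeasurableB.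
have sub : [set w | (eps <= cmod (filtered X g N t w - Y w))%R] `<=` [set w | (1 <= V w)%E].
  move=> w /= hw.
  have htri : eps <= cmod (filtered X g N t w - filtered X (fun=> f) N t w) +
      cmod (Y w - filtered X (fun=> f) N t w).
    rewrite -(cmodN (Y w - _)); apply: le_trans (le_cmodD _ _).
    by rewrite opprB addrA subrK.
  have [hb|hb] := leP (eps / 2) (cmod (Y w - filtered X (fun=> f) N t w)).
    apply: (@le_trans _ _ ((4 / eps ^+ 2)%:E * B w)%E); last by rewrite /V leeDr// mule_ge0// lee_fin.
    rewrite /B -EFinM lee_fin mulrAC ler_pdivlMr ?exprn_gt0// mul1r.
    have -> : eps ^+ 2 = 4 * (eps / 2) ^+ 2 by field.
    by rewrite ler_pM2l// ler_sqr ?nnegrE ?cmod_ge0// divr_ge0// ltW.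
  apply: (@le_trans _ _ ((2 / eps)%:E * U w)%E); last by rewrite /V leeDl// mule_ge0// lee_fin.
  have ha : eps / 2 <= cmod (filtered X g N t w - filtered X (fun=> f) N t w) by lra.
  have := lee_wpmul2l (x := (2 / eps)%:E) _ (AU w); rewrite lee_fin => /(_ c20).
  apply: le_trans; rewrite -EFinM lee_fin.
  have E1 : 2 / eps * (eps / 2) = 1 by field; rewrite gt_eqF.
  by rewrite -[leLHS]E1 ler_wpM2l.
apply: (@le_trans _ _ (P [set w | (1 <= V w)%E])).
  apply: le_measure => //; rewrite inE//.
  by rewrite -[X in measurable X]setTI; exact: emeasurable_fun_c_infty.
apply: (le_trans (markov_ge0 P mV V0)).
rewrite /V ge0_integralD//; last 4 first.
- by move=> w _; rewrite mule_ge0// lee_fin.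
- exact: measurable_funeM.
- by move=> w _; rewrite mule_ge0// lee_fin.
- exact: measurable_funeM.
rewrite !ge0_integralZl_EFin// EFinD; apply: leeD; last first.
  by rewrite [leRHS]EFinM; apply: lee_wpmul2l => //; rewrite lee_fin.
have -> : 4 * (M + 1) / eps / N.+1%:R = 2 / eps * (2 * (M + 1) / n1).
  by rewrite /n1; field; rewrite gt_eqF// gt_eqF// ltr0n.
rewrite [leRHS]EFinM; apply: lee_wpmul2l; first by rewrite lee_fin.
rewrite /U ge0_integralD//; last 4 first.
- by move=> w _; rewrite mule_ge0// lee_fin ltW.
- exact: measurable_funeM.
- by move=> w _; rewrite mule_ge0// lee_fin.
- exact: measurable_funeM.
rewrite !ge0_integralZl_EFin//; last exact: ltW.
have -> : (\int[P]_w S w = (K * M)%:E)%E.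
  rewrite ge0_integral_sum//; last by move=> k w _; exact: sqnormH_ge0.
  under eq_bigr do rewrite XM.
  by rewrite sumEFin sumr_const card_ord -mulr_natl.
have K2 : K <= 2 * n1.
  by rewrite /K /n1 -natrM ler_nat mul2n doubleS ltnS leqnSn.
have -> : 2 * (M + 1) / n1 = eta * (2 * n1 * M) + 2 * n1 * eta^-1 * n1 ^- 4.
  by rewrite /eta; field; rewrite gt_eqF.
rewrite EFinD; apply: leeD.
  by rewrite -EFinM lee_fin ler_wpM2l ?(ltW eta0)// ler_wpM2r.
have n4 : 0 <= n1 ^- 4 by rewrite invr_ge0 exprn_ge0// ltW.
have DE : (\int[P]_w D w <= (n1 ^- 4)%:E)%E.
  have := lee_wpmul2l (x := (n1 ^- 4)%:E) _ hD; rewrite lee_fin => /(_ n4).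
  by rewrite muleA -EFinM mulVf ?mul1e ?mule1// gt_eqF// exprn_gt0.
apply: (@le_trans _ _ ((K * eta^-1)%:E * (n1 ^- 4)%:E)%E).
  by apply: lee_wpmul2l => //; rewrite lee_fin.
rewrite -EFinM lee_fin; apply: ler_wpM2r => //; apply: ler_wpM2r => //.
by rewrite invr_ge0 ltW.
Qed.

End Deviation.

(** * Convergence of the estimated scores *)

Theorem theorem3 (R : realType) (d : measure_display) (Omega : measurableType d)
  (P : probability Omega R)
  (b : nat -> R -> R[i]) (hb : orthonormal_basis b)
  (X : int -> Omega -> R -> R[i])
  (hX : weakly_stationary_zero_mean P X)
  (hC : (\esum_(h in [set: int]) hsnorm b (autocov_op P X h) < +oo)%E)
  (F : R -> oper R) (hF : spectral_density_operator P b X F)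
  (lam : R -> nat -> R)
  (hlam : forall theta m, freqI theta -> nth_eigenvalue (F theta) m (lam theta m))
  (phi : nat -> R -> R -> R[i])
  (hphi_meas : forall m, cmeasurable_fun (@freqI R `*` @unitI R)
     (fun p : measurableTypeR R * measurableTypeR R => phi m p.1 p.2))
  (hphi : forall m theta, freqI theta -> unit_eigenfunction (F theta) (lam theta m) (phi m theta))
  (Y : nat -> int -> Omega -> R[i])
  (hY : forall m t, mean_square_filtered P X (filter_coef (phi m)) t (Y m t))
  (* the estimator of F theta, as a function of the sample X_1, ..., X_n *)
  (Fhat : forall n : nat, ('I_n -> R -> R[i]) -> R -> oper R)
  (hFhat_HS : forall n w theta, freqI theta ->
     hilbert_schmidt b (Fhat n (sample X n w) theta) /\
     self_adjoint (Fhat n (sample X n w) theta))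
  (hFhat_meas : forall n x y, inH x -> inH y ->
     cmeasurable_fun (setT `*` @freqI R)
       (fun p : Omega * measurableTypeR R =>
          inner (Fhat n (sample X n p.1) p.2 x) y))
  (p : nat)
  (phihat : nat -> nat -> Omega -> R -> R -> R[i])
  (hphihat_meas : forall n m, (m < p)%N ->
     cmeasurable_fun (setT `*` @freqI R `*` @unitI R)
       (fun q : Omega * measurableTypeR R * measurableTypeR R =>
          phihat n m q.1.1 q.1.2 q.2))
  (hphihat : forall n m w theta, (m < p)%N -> freqI theta ->
     nth_unit_eigenfunction (Fhat n (sample X n w) theta) m (phihat n m w theta))
  (B1 : (fun n => \int[@lebesgue_measure R]_(theta in @freqI R)
           \int[P]_w (hsnorm b (op_sub (F theta) (Fhat n (sample X n w) theta))) ^+ 2)%E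
         @ \oo --> 0%E)
  (B2 : forall m, finite_set [set theta | freqI theta /\ alpha (lam theta) m = 0])
  (v : R -> R[i]) (hv : inH v)
  (B3 : forall m, (m < p)%N ->
     {ae @lebesgue_measure R, forall theta, freqI theta -> inner (phi m theta) v <> 0})
  (horient : forall m, (m < p)%N ->
     {ae @lebesgue_measure R, forall theta, freqI theta -> 0 <= inner (phi m theta) v})
  (horienthat : forall n m w, (m < p)%N ->
     {ae @lebesgue_measure R, forall theta, freqI theta ->
        0 <= inner (phihat n m w theta) v}) :
  let Yhat (L : nat -> nat) (n m : nat) (t : int) : Omega -> R[i] :=
    filtered X (fun w => filter_coef (phihat n m w)) (L n) t in
  exists L : nat -> nat,
    [/\ L @ \oo --> \oo,
        \forall n \near \oo, (2 * L n < n)%N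
      & forall m, (m < p)%N ->
          (forall t : int,
             vanishes_in_probability P (fun n w => Yhat L n m t w - Y m t w)) /\
          (forall t_ : nat -> int,
             (\forall n \near \oo,
                (L n)%:Z + 1 <= t_ n /\ t_ n <= n%:Z - (L n)%:Z) ->
             vanishes_in_probability P
               (fun n w => Yhat L n m (t_ n) w - Y m (t_ n) w))].
Proof.
move=> Yhat.
have hproc : H_process X by case: hX.
have mfreq := @measurable_freqI R; have mI := @measurable_unitI R.
have freq_fin : (@lebesgue_measure R (@freqI R) < +oo)%E by rewrite lebesgue_freqI ltry.
have hphi_unit m theta : freqI theta -> inH (phi m theta) /\ sqnormH (phi m theta) = 1%E.
  by move=> ft; have [[]] := hphi m theta ft.
have jphi m : joint_L2 (phi m).
  split; first exact: hphi_meas.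
  rewrite (eq_integral (cst 1%E)); last by move=> s; rewrite inE => /(hphi_unit m)[].
  rewrite integral_cst; last exact: mfreq.
  by rewrite mul1e; exact: freq_fin.
have jphihat n m w : (m < p)%N -> joint_L2 (phihat n m w).
  move=> mp; split.
    apply: (cmeasurable_comp (g := fun z : measurableTypeR R * measurableTypeR R =>
      ((w, z.1), z.2)) _ _ _ (hphihat_meas n m mp)).
    - exact: (measurableX (measurableX measurableT mfreq) mI).
    - by move=> [? ?] [].
    - apply: measurable_funTS; apply: measurable_fun_pair; last exact: measurable_snd.
      by apply: measurable_fun_pair; [exact: measurable_cst|exact: measurable_fst].
  rewrite (eq_integral (cst 1%E)); last first.
    by move=> s; rewrite inE => fs; have [l _ [_]] := hphihat n m w s mp fs.
  rewrite integral_cst; last exact: mfreq.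
  by rewrite mul1e; exact: freq_fin.
pose T n w theta := Fhat n (sample X n w) theta.
pose D m n w := (\int[@lebesgue_measure R]_(theta in @freqI R)
  eigen_error (phi m) (phihat ^~ m) n w theta)%E.
have D0 m n w : (0 <= D m n w)%E by apply: integral_ge0 => th _; exact: eigen_error_ge0.
have Dcvg m : (m < p)%N -> (fun n => \int[P]_w D m n w)%E @ \oo --> 0%E.
  move=> mp; apply: (@eigenfunctions_consistent R d Omega P b hb F T _ _ _ _ lam m (phi m)
    (fun n => phihat n m) _ _ _ _ _ _ _ v hv).
  - by move=> theta /hF[].
  - by move=> n w theta ft; have [] := hFhat_HS n w theta ft.
  - by move=> k j; exact: (measurable_spectral_coord hproc hb hF).
  - by move=> n k j; apply: hFhat_meas; exact: hb.1.1.
  - by move=> theta k ft; exact: hlam.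
  - exact: hphi_meas.
  - by move=> theta ft; exact: hphi.
  - by move=> n; exact: hphihat_meas.
  - by move=> n w theta ft; exact: hphihat.
  - exact: B1.
  - exact: B2.
  - exact: B3.
  - exact: horient.
  - by move=> n w; exact: horienthat.
pose dn n := (\sum_(m < p) \int[P]_w D m n w)%E.
have dn0 : dn @ \oo --> 0%E.
  have -> : 0%E = (\sum_(m < p) 0)%E :> \bar R by rewrite big1.
  apply: cvg_nnesum => m _; last exact: Dcvg.
  by apply: nearW => n; apply: integral_ge0 => w _; exact: D0.
have [L [Loo Ln Ld]] := slow_index dn0.
exists L; split => //.
have [_ Xfin _ _] := hX.
pose M := fine (\int[P]_w sqnormH (X 0%R w))%E.
have XM t : (\int[P]_w sqnormH (X t w) = M%:E)%E.
  rewrite (@expected_sqnorm_const R d Omega P X hX b t hb) fineK// ge0_fin_numE ?Xfin//.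
  by apply: integral_ge0 => w _; exact: sqnormH_ge0.
have M0 : 0 <= M by apply: fine_ge0; apply: integral_ge0 => w _; exact: sqnormH_ge0.
have phat_inH m : (m < p)%N -> forall n w l, inH (filter_coef (phihat n m w) l).
  by move=> mp n w l; exact: inH_filter_coef (jphihat n m w mp) l.
have mfil (f : Omega -> int -> R -> R[i]) N t :
    (forall l, cmeasurable_fun (setT `*` @unitI R)
       (fun p : Omega * measurableTypeR R => f p.1 l p.2)) ->
    cmeasurable_fun setT (filtered X f N t).
  move=> mf; apply: cmeasurable_sum => k.
  exact: (measurable_inner measurableT (measurable_process hproc _) (mf _)).
(* The bound is uniform in [t], hence covers fixed and moving times alike. *)
suff uniform m : (m < p)%N -> forall eps e : R, 0 < eps -> 0 < e ->
    \forall n \near \oo, forall t,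
      (P [set w | (eps <= cmod (Yhat L n m t w - Y m t w))%R] <= e%:E)%E.
  move=> m mp; split=> [t|t_ _] eps e0; apply: near_cvge0 => // e he.
    by have := uniform m mp eps e e0 he; apply: filterS => n; exact.
  by have := uniform m mp eps e e0 he; apply: filterS => n; exact.
move=> mp eps e eps0 e0.
have mphat n l : cmeasurable_fun (setT `*` @unitI R)
    (fun p : Omega * measurableTypeR R => filter_coef (phihat n m p.1) l p.2).
  exact: (measurable_filter_coef l measurableT (hphihat_meas n m mp)).
have mcoef l : cmeasurable_fun (setT `*` @unitI R)
    (fun p : Omega * measurableTypeR R => filter_coef (phi m) l p.2).
  by apply: measurable_snd_comp; exact: filter_coef_measurable.
(* This truncation error contributes [e / 2] to the bound of [deviation_bound]. *)
have e1 : 0 < e / 2 * (eps ^+ 2 / 4) by rewrite !mulr_gt0 ?divr_gt0 ?exprn_gt0.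
have [N0 _ hN0] := mean_square_filtered_uniform hX (inH_filter_coef (jphi m)) (hY m) e1.
(* From this lag on the estimation error contributes at most [e / 2]. *)
pose k0 := Num.Def.trunc (8 * (M + 1) / eps / e).
near=> n => t.
have LN0 : (N0 <= L n)%N.
  by near: n; move/cvgnyPge : Loo; exact.
have Lk0 : (k0 <= L n)%N.
  by near: n; move/cvgnyPge : Loo; exact.
have hd : (((L n).+1%:R ^+ 4)%:E * \int[P]_w D m n w <= 1)%E.
  apply: (@le_trans _ _ (((L n).+1%:R ^+ 4)%:E * dn n)%E); last by near: n.
  apply: lee_wpmul2l; first by rewrite lee_fin exprn_ge0.
  rewrite /dn (bigD1 (Ordinal mp))//= leeDl// sume_ge0// => j _.
  by apply: integral_ge0 => w _; exact: D0.
have mDn : measurable_fun setT (D m n).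
  have mE := @measurable_eigen_error R d Omega (phi m) (phihat^~ m) (hphi_meas m)
    (fun n => hphihat_meas n m mp) n.
  apply: (measurable_parametric_integral (@lebesgue_measure R) measurableT mfreq mE).
  by move=> z _; exact: eigen_error_ge0.
have hdiff w l : (sqnormH (fun u => filter_coef (phihat n m w) l u - filter_coef (phi m) l u)%R
    <= D m n w)%E.
  exact: (sqnormH_filter_coefB_le l (jphihat n m w mp) (jphi m)).
have := @deviation_bound _ _ _ P X hproc M XM (filter_coef (phi m))
  (fun w => filter_coef (phihat n m w)) (D m n) (Y m t) (L n) t eps _ eps0
  (inH_filter_coef (jphi m)) (phat_inH m mp n) hdiff mDn (D0 m n) hd
  (mfil _ _ _ (mphat n)) (mfil _ _ _ mcoef) (hY m t).1 (hN0 _ LN0 t).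
move=> h; apply: (le_trans h); rewrite lee_fin.
have -> : 4 / eps ^+ 2 * (e / 2 * (eps ^+ 2 / 4)) = e / 2 by field; rewrite gt_eqF.
rewrite [leRHS](splitr e) lerD2r ler_pdivrMr ?ltr0n//.
have hk : 8 * (M + 1) / eps / e <= (L n).+1%:R.
  apply: ltW; apply: lt_le_trans (truncnS_gt _) _; by rewrite ler_nat ltnS.
have -> : 4 * (M + 1) / eps = e / 2 * (8 * (M + 1) / eps / e).
  by field; rewrite !gt_eqF.
by apply: ler_wpM2l => //; rewrite divr_ge0// ltW.
Unshelve. all: by end_near. Qed.
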